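(* Let $\Lambda$ be an unbounded subset of $(1,\infty)$, let $m\ge1$ and let $F_1,\ldots,F_m:\Lambda\to(0,\infty)$ be functions such that $F_j(\lambda)\to\infty$ as $\lambda\to\infty$ for every $j$ and $F_{j+1}(\lambda)=o(F_j(\lambda)^{\alpha})$ as $\lambda\to\infty$ for every $\alpha>0$ and $1\le j<m$. Let $X$ be a locally convex space that is the inductive limit of a system of Fréchet spaces, and for each $\lambda\in\Lambda$ let $y_\lambda\in X'$. Suppose that for each $x\in X$ the finite part of the limit $Y(x)=\mathrm{F.p.}\lim_{\lambda\to\infty}\langle y_\lambda,x\rangle$ (with respect to the system of basic infinite functions determined by $F_1,\ldots,F_m$) exists. Then $Y\in X'$. Likewise, $R_{\vec{\alpha}}$ is a continuous linear functional on $X$ for each $\vec{\alpha}\in[0,\infty)^m\setminus\{(0,\ldots,0)\}$. Moreover, while for each $x\in X$ the set $\{\vec{\alpha}:R_{\vec{\alpha}}(x)\ne0\}$ is finite, the set $\{\vec{\alpha}:R_{\vec{\alpha}}\ne0\}$ could be infinite and not bounded above; that is, there exist $\Lambda$, $F_1,\ldots,F_m$, $X$ and $\{y_\lambda\}_{\lambda\in\Lambda}$ satisfying all the hypotheses above for which the set $\{\vec{\alpha}:R_{\vec{\alpha}}\ne0\}$ is infinite and not bounded above.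
   Context: $K$ is $\mathbb{R}$ or $\mathbb{C}$, the scalar field of $X$; $X'$ is the space of continuous linear functionals on $X$, and $\langle y,x\rangle$ is the evaluation of $y\in X'$ at $x\in X$. Inductive limit: $X$ is the (locally convex) inductive limit of an inductive system of Fréchet spaces $(X_i)_{i\in I}$ with canonical linear maps $u_i:X_i\to X$, and $X$ carries the finest locally convex topology making all the maps $u_i$ continuous. Let $\mathfrak{E}=[0,\infty)^m\setminus\{(0,\ldots,0)\}$ with the lexicographical order $\prec$, and for $\vec{\alpha}=(\alpha_1,\ldots,\alpha_m)\in\mathfrak{E}$ let $\mathbf{F}^{\vec{\alpha}}=F_1^{\alpha_1}F_2^{\alpha_2}\cdots F_m^{\alpha_m}$. The functions $\mathbf{F}^{\vec\alpha}$, $\vec\alpha\in\mathfrak{E}$, are the basic infinite functions. (The case $m=1$, $F_1(\lambda)=\lambda$ gives standard finite parts; the case $m=2$, $F_1(\lambda)=\lambda$, $F_2(\lambda)=\ln\lambda$ gives Hadamard finite parts.) Finite part: for a given $x\in X$, the finite part $\mathrm{F.p.}\lim_{\lambda\to\infty}\langle y_\lambda,x\rangle$ exists and equals $Y(x)\in K$ if there are an integer $k=k_x\ge0$, exponents $\vec{\alpha}_1\succ\cdots\succ\vec{\alpha}_k$ in $\mathfrak{E}$ and scalars $R_{\vec{\alpha}_1}(x),\ldots,R_{\vec{\alpha}_k}(x)\in K\setminus\{0\}$ (all allowed to depend on $x$), and scalars $z_\lambda(x)\in K$, such that for all $\lambda\in\Lambda$ $$\langle y_\lambda,x\rangle=\mathbf{F}^{\vec{\alpha}_1}(\lambda)R_{\vec{\alpha}_1}(x)+\cdots+\mathbf{F}^{\vec{\alpha}_k}(\lambda)R_{\vec{\alpha}_k}(x)+z_\lambda(x)$$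 and $\lim_{\lambda\to\infty,\,\lambda\in\Lambda}z_\lambda(x)=Y(x)$. Such a decomposition, when it exists, is unique. One sets $R_{\vec{\alpha}}(x)=0$ if $\vec{\alpha}\in\mathfrak{E}$ is not one of the exponents $\vec{\alpha}_1,\ldots,\vec{\alpha}_k$ occurring for $x$; this defines a function $R_{\vec{\alpha}}:X\to K$ for every $\vec{\alpha}\in\mathfrak{E}$. *)

(* Defs.v *)
From HB Require Import structures.
From mathcomp Require Import all_boot all_order all_algebra.
From mathcomp Require Import complex.
From mathcomp Require Import all_classical all_reals all_analysis.

Set Implicit Arguments.
Unset Strict Implicit.
Unset Printing Implicit Defensive.

Import Order.TTheory GRing.Theory Num.Theory.
Import numFieldNormedType.Exports.

Local Open Scope classical_set_scope.
Local Open Scope ring_scope.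

Inductive scalar_kind := RealScalars | ComplexScalars.

(* The topology of [scalars R k] is the one that the library puts on
   every numFieldType; for [R[i]] it is given by the complex modulus. *)
Definition scalars (R : realType) (k : scalar_kind) : numFieldType :=
  match k with
  | RealScalars => R : numFieldType
  | ComplexScalars => R[i] : numFieldType
  end.

Definition to_scalars (R : realType) (k : scalar_kind) : R -> scalars R k :=
  match k return R -> scalars R k with
  | RealScalars => id
  | ComplexScalars => real_complex R
  end.

Section TopologicalVectorSpaces.
Context (R : realType) (k : scalar_kind).
Local Notation K := (scalars R k).

(* Complete metrizable; local convexity is part of [tvsType].  The uniform
   structure bundled in a [tvsType] induces the topology but is not required to
   be the translation-invariant one, so completeness is not expressed with the
   library's [cauchy] but with the translation-invariant metric. *)
Definition frechet (V : tvsType K) : Prop :=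
  exists d : V -> V -> R,
    [/\ [/\ forall x y, d x y = 0 <-> x = y,
            forall x y, d x y = d y x &
            forall x y z, d x z <= d x y + d y z],
        forall x y z, d (x + z) (y + z) = d x y,
        forall x, nbhs x =
          filter_from [set e : R | 0 < e] (fun e => [set y | d x y < e]) &
        forall s : nat -> V,
          (forall e, 0 < e -> exists N, forall m n, (N <= m)%N -> (N <= n)%N ->
             d (s m) (s n) < e) ->
          exists l : V, s @ \oo --> l].

Definition dual (V : tvsType K) : set (V -> K) :=
  [set f | linear (f : V -> K^o) /\ continuous f].

Record inductive_system (I : Type) (le : I -> I -> Prop)
    (X_ : I -> tvsType K) (v : forall i j, X_ i -> X_ j) : Prop :=
  InductiveSystem {
    is_nonempty : inhabited I;
    is_refl : forall i, le i i;
    is_trans : forall i j l, le i j -> le j l -> le i l;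
    is_directed : forall i j, exists2 l, le i l & le j l;
    is_linear : forall i j, le i j -> linear (@v i j);
    is_continuous : forall i j, le i j -> continuous (@v i j);
    is_id : forall i x, v i i x = x;
    is_comp : forall i j l x, le i j -> le j l -> v j l (v i j x) = v i l x
  }.

(* The first four fields say that [X] is, as a vector space, the quotient of the
   disjoint union of the [X_ i] that identifies [x : X_ i] and [y : X_ j] when
   they have the same image in some [X_ l].  In the last one, a locally convex
   topology on the vector space [X] is given as a tvs [E] with a linear
   bijection [f] from [X] to [E]; being coarser than the topology of [X] is the
   continuity of [f]. *)
Record inductive_limit (I : Type) (le : I -> I -> Prop)
    (X_ : I -> tvsType K) (v : forall i j, X_ i -> X_ j)
    (X : tvsType K) (u : forall i, X_ i -> X) : Prop :=
  InductiveLimit {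
    il_linear : forall i, linear (u i);
    il_compatible : forall i j x, le i j -> u j (v i j x) = u i x;
    il_surjective : forall z, exists i, exists x, u i x = z;
    il_separated : forall i j x y, u i x = u j y ->
      exists l, [/\ le i l, le j l & v i l x = v j l y];
    il_continuous : forall i, continuous (u i);
    il_finest : forall (E : tvsType K) (f : {linear X -> E}), bijective f ->
      (forall i, continuous (f \o u i)) -> continuous f
  }.

Definition frechet_inductive_limit (X : tvsType K) : Prop :=
  exists (I : Type) (le : I -> I -> Prop) (X_ : I -> tvsType K)
    (v : forall i j, X_ i -> X_ j) (u : forall i, X_ i -> X),
    [/\ forall i, frechet (X_ i), inductive_system le v &
        inductive_limit le v u].

End TopologicalVectorSpaces.
Arguments dual {R k} V _.

Section FiniteParts.
Context (R : realType) (m : nat).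
Implicit Types (L : set R) (F : 'I_m -> R -> R).

Definition unbounded_domain L : Prop :=
  L `<=` [set l | 1 < l] /\ ~ has_ubound L.

Definition infty_in L : filter_on R :=
  FilterType (within L (pinfty_nbhs R)) (within_filter L _).

Record basic_system L F : Prop := BasicSystem {
  bs_pos : forall j l, L l -> 0 < F j l;
  bs_infty : forall j, F j l @[l --> infty_in L] --> +oo;
  bs_littleo : forall i j : 'I_m, j = i.+1 :> nat -> forall a : R, 0 < a ->
    F j =o_ (infty_in L) (fun l => F i l `^ a)
}.

(* The order of [m.-tuplelexi R] is the lexicographical one. *)
Definition exponent : set (m.-tuplelexi R) :=
  [set a | (forall j, 0 <= tnth a j) /\ exists j, tnth a j != 0].

Definition basic_fun F (a : m.-tuplelexi R) (l : R) : R :=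
  \prod_(j < m) F j l `^ tnth a j.

Section Expansion.
Context (k : scalar_kind).
Local Notation K := (scalars R k).
Implicit Types (g : R -> K) (r : m.-tuplelexi R -> K).

(* [r] is the whole family of coefficients, extended by zero outside of the
   finitely many exponents [s] that occur. *)
Definition fp_expansion L F g (Y : K) r : Prop :=
  exists (s : seq (m.-tuplelexi R)) (z : R -> K),
    [/\ {in s, forall a, exponent a},
        sorted >%O s,
        forall a, (r a != 0) = (a \in s),
        forall l, L l ->
          g l = \sum_(a <- s) to_scalars k (basic_fun F a l) * r a + z l &
        z l @[l --> infty_in L] --> Y].

Definition fp_exists L F g : Prop := exists Y r, fp_expansion L F g Y r.

(* [fp_lim] and [fp_coef] are meaningful when [fp_exists L F g] holds, in which
   case [Y] and [r] are unique. *)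
Definition fp_lim L F g : K := xget 0 [set Y | exists r, fp_expansion L F g Y r].

Definition fp_coef L F g : m.-tuplelexi R -> K :=
  xget (fun=> 0) [set r | exists Y, fp_expansion L F g Y r].

End Expansion.
End FiniteParts.

(* Main.v *)
From HB Require Import structures.
Require Import Defs.
From mathcomp Require Import all_boot all_order all_algebra.
From mathcomp Require Import complex.
From mathcomp Require Import ring.
From mathcomp Require Import all_classical all_reals all_analysis.

(** Uniqueness of expansions makes the finite part and all the coefficients
linear in x, so continuity is the issue, and by the finest-topology property of
the inductive limit it can be tested on each Frechet space X_i of the system
([inductive_limit_continuous]).  The limit property speaks of locally convex
topologies rather than of functionals; it is applied to the topology on X
generated by the original one and by the functional f under study, which is the
initial topology of the graph map x |-> (x, f x).

Two devices simplify the work on a Frechet space.  First, one restricts the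
parameter to a sequence in Lambda that tends to infinity.  Second, the zero
exponent is admitted, whose basic function is 1: then the finite part is the
coefficient of the zero exponent and needs no separate treatment, and an
expansion is a finite sum of basic functions up to o(1) ([expands]).

Let E be the set of exponents whose coefficient is not identically zero on the
Frechet space.  Every set of exponents has a countable cofinal subset for the
lexicographical order ([lexi_cofinal_seq]), so the space is a countable union of
closed sets {x : |y_n x| <= N F^c(n) for all n} with c in a cofinal sequence of
E.  By Baire one of them is a neighbourhood of some point, which forces c to be
the largest element of E, and then R_c = lim y_n / F^c is continuous by the
Banach-Steinhaus argument ([leading_coef_continuous]).

Now let C be the set of those exponents in E whose coefficient is continuous. It
is finite: otherwise the space would be covered by the kernels of countably many
nonzero continuous functionals, because each x has only finitely many exponents.
Subtracting the finitely many terms of C from y_n leaves a family whose set of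
exponents is E minus C; if this set were not empty, its largest element would
have a continuous coefficient and would belong to C.  Hence E = C
([expands_coef_continuous]).

For the second part, X is the space of polynomials with the finest locally
convex topology, the union of the spaces K^n; y_lambda is evaluation at lambda,
and F_1, F_2, ... are lambda, ln lambda, ln ln lambda, ...  The coefficient of
X^n in p is the coefficient of the exponent (n, 0, ..., 0). *)

Set Implicit Arguments.
Unset Strict Implicit.
Unset Printing Implicit Defensive.

Import Order.TTheory GRing.Theory Num.Theory.
Import numFieldNormedType.Exports.

Local Open Scope classical_set_scope.
Local Open Scope ring_scope.

(** * Baire category for complete metrics *)

(** If no closed set contained a ball, one could choose nested closed balls, the
n-th missing the n-th set and with radii tending to 0; their centers converge to
a point outside all the sets.  The metric is explicit because the uniform
structure of a locally convex space need not be given by it. *)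
Lemma baire_complete_metric (R : realType) (V : topologicalType)
    (d : V -> V -> R) (A : nat -> set V) (x0 : V) :
    (forall x y, d x y = 0 <-> x = y) ->
    (forall x y, d x y = d y x) ->
    (forall x y z, d x z <= d x y + d y z) ->
    (forall x, nbhs x =
       filter_from [set e : R | 0 < e] (fun e => [set y | d x y < e])) ->
    (forall s : nat -> V,
       (forall e : R, 0 < e -> exists N, forall m n, (N <= m)%N -> (N <= n)%N ->
          d (s m) (s n) < e) ->
       exists l : V, s @ \oo --> l) ->
    (forall n, closed (A n)) -> (forall x, exists n, A n x) ->
  exists n x, exists2 e : R, 0 < e & forall y, d x y < e -> A n y.
Proof.
move=> d0 dC dT nbhsE complete_d clA covA; apply: contrapT => noball.
have dxx x : d x x = 0 by apply/d0.
have hole n x e : 0 < e -> exists2 y, d x y < e & ~ A n y.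
  move=> e0; apply: contrapT => h; apply: noball; exists n, x, e => // y xy.
  by apply: contrapT => nA; apply: h; exists y.
have step n (b : V * R) : exists c : V * R, 0 < b.2 ->
    [/\ 0 < c.2, c.2 <= n.+1%:R^-1, forall z, d c.1 z <= c.2 -> ~ A n z &
        forall z, d c.1 z <= c.2 -> d b.1 z <= b.2].
  case: b => x e /=; have [e0|] := ltrP 0 e; last by exists (x, e).
  have [y xy nAy] := hole n x e e0.
  have : nbhs y (~` A n).
    by apply: open_nbhs_nbhs; split=> //; exact: closed_openC.
  rewrite nbhsE => -[r /= r0 rA].
  pose t := Order.min (r / 2) (Order.min (e - d x y) n.+1%:R^-1).
  have t0 : 0 < t by rewrite !lt_min divr_gt0//= subr_gt0 xy invr_gt0 ltr0n.
  have tr : t <= r / 2 by rewrite ge_min lexx.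
  have te : t <= e - d x y by rewrite !ge_min lexx orbT.
  have tn : t <= n.+1%:R^-1 by rewrite !ge_min lexx !orbT.
  exists (y, t) => _ /=; split=> // z yz.
    by apply: rA; rewrite /=; apply: (le_lt_trans (le_trans yz tr)); rewrite
      ltr_pdivrMr// ltr_pMr// ltr1n.
  by rewrite (le_trans (dT x y z))// addrC -lerBrDr (le_trans yz).
have [f hf] : {f : nat -> V * R -> V * R | forall n b, 0 < b.2 ->
    [/\ 0 < (f n b).2, (f n b).2 <= n.+1%:R^-1,
        forall z, d (f n b).1 z <= (f n b).2 -> ~ A n z &
        forall z, d (f n b).1 z <= (f n b).2 -> d b.1 z <= b.2]}.
  exists (fun n b => sval (cid (step n b))) => n b.
  by case: cid => c /= hc; exact: hc.
pose b := fix b n := if n is n'.+1 then f n' (b n') else (x0, 1).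
have b0 n : 0 < (b n).2 by elim: n => //= n /(hf n)[].
have bS n : [/\ (b n.+1).2 <= n.+1%:R^-1,
    forall z, d (b n.+1).1 z <= (b n.+1).2 -> ~ A n z &
    forall z, d (b n.+1).1 z <= (b n.+1).2 -> d (b n).1 z <= (b n).2].
  by have [] := hf n _ (b0 n).
have nest n m z : d (b (n + m)%N).1 z <= (b (n + m)%N).2 ->
    d (b n).1 z <= (b n).2.
  elim: m => [|m IH]; rewrite ?addn0// addnS.
  by have [_ _ h] := bS (n + m)%N; move=> /h.
have close n m : (n <= m)%N -> d (b n).1 (b m).1 <= (b n).2.
  by move=> /subnKC <-; apply: nest (m - n)%N _ _; rewrite dxx ltW.
have [|l bl] := complete_d (fst \o b).
  move=> e e0; pose N := Num.truncn (2 / e); exists N.+1 => m n Nm Nn /=.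
  apply: le_lt_trans (dT _ (b N.+1).1 _) _; rewrite [d (b m).1 _]dC.
  have small : (b N.+1).2 < e / 2.
    have [+ _ _] := bS N; move=> /le_lt_trans; apply.
    rewrite -[ltRHS]invrK ltf_pV2 ?posrE ?ltr0n ?invr_gt0 ?divr_gt0// invfM invrK.
    by rewrite mulrC; exact: truncnS_gt.
  rewrite [e]splitr; apply: ltrD; apply: le_lt_trans small; exact: close.
(* The balls are closed, so the limit of the centers lies in each of them. *)
have dl n : d (b n).1 l <= (b n).2.
  apply/ler_addgt0Pr => e e0.
  have : nbhs l [set y | d l y < e] by rewrite nbhsE; exists e.
  move=> /bl[N _ /(_ (maxn N n) (leq_maxl _ _))] /= le.
  rewrite (le_trans (dT _ (b (maxn N n)).1 _))// lerD//.
    exact/close/leq_maxr.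
  by rewrite dC ltW.
have [n Anl] := covA l.
by have [_ /(_ l (dl _))] := bS n.
Qed.

(** * Linear functionals on topological vector spaces *)

Section ScalarLinear.
Context (K : numFieldType) (V : lmodType K) (f : V -> K).
Hypothesis linf : linear (f : V -> K^o).

Lemma linear_scalar0 : f 0 = 0.
Proof. by have := linf (-1) 0 0; rewrite scaler0 addr0 scaleN1r addNr. Qed.

Lemma linear_scalarD x y : f (x + y) = f x + f y.
Proof. by have := linf 1 x y; rewrite !scale1r. Qed.

Lemma linear_scalarZ a x : f (a *: x) = a * f x.
Proof. by have := linf a x 0; rewrite !addr0 linear_scalar0 addr0. Qed.

Lemma linear_scalarB x y : f (x - y) = f x - f y.
Proof. by rewrite linear_scalarD -scaleN1r linear_scalarZ mulN1r. Qed.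

End ScalarLinear.

Lemma nbhs0_absorbs (K : numFieldType) (V : tvsType K) (U : set V) (x : V) :
  nbhs 0 U -> exists2 c : K, 0 < c & U (c *: x).
Proof.
move=> U0; have := @scale_continuous K V (0, x) U; rewrite /= scale0r => /(_ U0).
move=> [[A B] /= [A0 Bx] AB]; move: A0 => /nbhs_ballP[e /= e0 eA].
exists (e / 2); first by rewrite divr_gt0.
apply: (AB (e / 2, x)); split => /=; last exact: nbhs_singleton.
apply: eA; rewrite -ball_normE /= sub0r normrN gtr0_norm ?divr_gt0//.
by rewrite ltr_pdivrMr// ltr_pMr// ltr1n.
Qed.

(** A functional bounded by M on a neighbourhood U of 0 is smaller than e on the
neighbourhood (e / (M + 1)) U. *)
Lemma linear_scalar_continuous (K : numFieldType) (V : tvsType K) (f : V -> K)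
    (U : set V) (M : K) :
  linear (f : V -> K^o) -> nbhs 0 U -> (forall x, U x -> `|f x| <= M) ->
  continuous f.
Proof.
move=> linf U0 fM x.
have M1 : 0 < M + 1.
  by rewrite ltr_wpDl//; apply: le_trans (fM 0 (nbhs_singleton U0)).
apply/cvgrPdist_lt => e e0; pose c := e / (M + 1).
have c0 : 0 < c by rewrite divr_gt0.
have := nbhsT x (nbhs0Z (lt0r_neq0 c0) U0); apply: filterS.
move=> _ [_ [u Uu <-] <-] /=.
rewrite distrC -linear_scalarB// addrC addKr linear_scalarZ// normrM gtr0_norm//.
by rewrite mulrAC ltr_pdivrMr// ltr_pM2l// (le_lt_trans (fM _ Uu))// ltrDl.
Qed.

(** * Finite expansions along a scale *)

(** Lets the same coefficients be summed over any larger list of exponents, so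
that two expansions can be compared over a common list. *)
Lemma big_seq_support (M : nmodType) (T : choiceType) (s s' : seq T)
    (F : T -> M) :
  uniq s -> uniq s' -> {subset s <= s'} -> (forall a, a \notin s -> F a = 0) ->
  \sum_(a <- s') F a = \sum_(a <- s) F a.
Proof.
move=> us us' ss' F0; rewrite (bigID (mem s)) /= [X in _ + X]big1// addr0.
rewrite -big_filter; apply: perm_big; apply: uniq_perm => //.
  exact: filter_uniq.
by move=> a; rewrite mem_filter /=; case: (boolP (a \in s)) => //= /ss' ->.
Qed.

Lemma seq_has_max disp (T : orderType disp) (s : seq T) (a : T) : a \in s ->
  exists2 b, b \in s & {in s, forall c, (c <= b)%O}.
Proof.
elim: s a => // c [|c' s] IH a _.
  by exists c; rewrite ?mem_head// => d; rewrite inE => /eqP ->.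
have [b bs bmax] := IH c' (mem_head _ _).
case: (leP c b) => cb.
  exists b; first by rewrite in_cons bs orbT.
  by move=> d; rewrite in_cons => /predU1P[->//|/bmax].
exists c; rewrite ?mem_head// => d; rewrite in_cons => /predU1P[->//|/bmax].
by move=> db; rewrite (le_trans db)// ltW.
Qed.

Section Expansions.
Context (K : numFieldType) (disp : Order.disp_t) (T : orderType disp).
Context (P : set T) (G : T -> nat -> K).
Hypothesis G_gt0 : forall a n, P a -> 0 < G a n.
Hypothesis G_ratio : forall a b, P a -> P b -> (a < b)%O ->
  (fun n => G a n / G b n) @ \oo --> (0 : K).
Hypothesis G_inv : forall a, P a -> cvg ((fun n => (G a n)^-1) @ \oo).

(** The scale G plays the role of the basic functions along a sequence, with the
constant function 1 as a possible member; the constant term of a finite-part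
expansion is then an ordinary coefficient.  The list s may contain exponents
with zero coefficient. *)
Definition expands (g : nat -> K) (r : T -> K) :=
  exists s : seq T, [/\ uniq s, {in s, forall a, P a},
    forall a, a \notin s -> r a = 0 &
    (fun n => g n - \sum_(a <- s) G a n * r a) @ \oo --> (0 : K)].

Lemma expandsP g r a : expands g r -> r a != 0 -> P a.
Proof.
by move=> [s [_ sP r0 _]]; case: (boolP (a \in s)) => [/sP//|/r0 ->]; rewrite eqxx.
Qed.

Lemma expands_linear c g g' r r' : expands g r -> expands g' r' ->
  expands (fun n => c * g n + g' n) (fun a => c * r a + r' a).
Proof.
move=> [s [us sP r0 cg]] [s' [us' sP' r0' cg']].
pose t := undup (s ++ s'); have ut : uniq t := undup_uniq _.
have st : {subset s <= t} by move=> a; rewrite mem_undup mem_cat => ->.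
have st' : {subset s' <= t} by move=> a; rewrite mem_undup mem_cat orbC => ->.
exists t; split=> //.
- by move=> a; rewrite mem_undup mem_cat => /orP[/sP|/sP'].
- move=> a; rewrite mem_undup mem_cat negb_or => /andP[/r0 -> /r0' ->].
  by rewrite mulr0 addr0.
have e0 : c * 0 + 0 = (0 : K) by rewrite mulr0 addr0.
rewrite -[X in _ --> X]e0 {e0}.
rewrite (_ : (fun n => _) = (fun n => c * (g n - \sum_(a <- s) G a n * r a) +
    (g' n - \sum_(a <- s') G a n * r' a))).
  by apply: cvgD => //; apply: cvgMr.
apply/funext => n; rewrite mulrBr addrACA -opprD mulr_sumr.
congr (_ - _); rewrite -(big_seq_support us ut st); last first.
  by move=> a /r0 ->; rewrite !mulr0.
rewrite -(big_seq_support us' ut st'); last by move=> a /r0' ->; rewrite mulr0.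
by rewrite -big_split; apply: eq_bigr => a _ /=; rewrite mulrDr mulrCA.
Qed.

(** After division by G b, the terms below b and the remainder tend to 0.  Zero is
allowed as the coefficient of b, so that one b serves many functions g. *)
Lemma expands_leading g r b : P b -> expands g r ->
    (forall a, (b < a)%O -> r a = 0) ->
  (fun n => g n / G b n) @ \oo --> r b.
Proof.
move=> Pb [s [us sP r0 cg]] rb.
rewrite (_ : (fun n => _) = (fun n =>
    (g n - \sum_(a <- s) G a n * r a) * (G b n)^-1 +
    \sum_(a <- s | a \in s) (G a n / G b n) * r a)); last first.
  apply/funext => n; rewrite -big_seq mulrBl mulr_suml.
  rewrite -[LHS]addr0 -addrA; congr (_ + _); apply/esym/eqP.
  by rewrite addrC subr_eq0; apply/eqP/eq_bigr => a _; rewrite mulrAC.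
have -> : r b = 0 * lim ((fun n => (G b n)^-1) @ \oo) +
    \sum_(a <- s | a \in s) (if a == b then r a else 0).
  rewrite mul0r add0r -big_seq.
  case: (boolP (b \in s)) => bs.
    rewrite (bigD1_seq b)//= eqxx big1 ?addr0// => a; by case: eqP.
  rewrite r0// big1_seq// => a /andP[_ sa].
  by case: eqP => // ab; rewrite -ab sa in bs.
apply: cvgD; first by apply: cvgM => //; exact: G_inv.
apply: cvg_big => //; first exact: add_continuous.
move=> a /sP Pa; case: eqVneq => [->|ab].
  rewrite (_ : (fun n => _) = fun=> r b); first exact: cvg_cst.
  by apply/funext => n; rewrite divff ?mul1r// gt_eqF// G_gt0.
have [lt_ab|lt_ba|/eqP] := ltgtP a b; last by rewrite (negPf ab).
  by rewrite -[X in _ --> X](mul0r (r a)); apply: cvgMl; exact: G_ratio.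
rewrite rb// (_ : (fun n => _) = fun=> 0); first exact: cvg_cst.
by apply/funext => n; rewrite mulr0.
Qed.

Lemma expands_max g r a : expands g r -> r a != 0 ->
  exists b, [/\ r b != 0, (a <= b)%O & forall c, (b < c)%O -> r c = 0].
Proof.
move=> [s [us sP r0 _]] ra.
have supp c : r c != 0 -> c \in [seq b <- s | r b != 0].
  by move=> rc; rewrite mem_filter rc /=; apply: contraNT rc => /r0 ->.
have [b] := seq_has_max (supp a ra).
rewrite mem_filter => /andP[rb _] bmax; exists b; split=> //.
  exact/bmax/supp.
move=> c bc; apply/eqP; apply: contraTT bc => /supp/bmax.
by rewrite leNgt.
Qed.

(** The difference of two expansions expands the zero function; its leading
coefficient is a limit of zeros. *)
Lemma expands_unique g r r' : expands g r -> expands g r' -> r =1 r'.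
Proof.
move=> gr gr' a; apply/eqP; rewrite -subr_eq0; apply: contraT => ra.
have := expands_linear (-1) gr' gr.
rewrite (_ : (fun n => -1 * g n + g n) = fun=> 0); last first.
  by apply/funext => n; rewrite mulN1r addNr.
set q := (X in expands _ X) => gq.
have qa : q a != 0 by rewrite /q mulN1r addrC.
have [b [qb _ bmax]] := expands_max gq qa.
have := expands_leading (expandsP gq qb) gq bmax.
rewrite (_ : (fun n => _) = fun=> 0); last by apply/funext => n; rewrite mul0r.
move=> /(cvg_lim (@norm_hausdorff _ _)) q0; move: qb.
by rewrite -q0 lim_cst ?eqxx//; exact: norm_hausdorff.
Qed.

Lemma expands_coef_linear (V : lmodType K) (y : nat -> V -> K)
    (r : V -> T -> K) a :
  (forall n, linear (y n : V -> K^o)) -> (forall x, expands (y ^~ x) (r x)) ->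
  linear (r ^~ a : V -> K^o).
Proof.
move=> liny yr c x x' /=.
have yc := expands_linear c (yr x) (yr x').
suff yc1 : expands (y ^~ (c *: x + x')) (fun a => c * r x a + r x' a).
  exact: (expands_unique (yr (c *: x + x')) yc1 a).
by move: yc; congr expands; apply/funext => n; rewrite liny.
Qed.

End Expansions.

(** * Coefficients on nonmeager spaces *)

(** The only consequence of completeness and metrizability that is used below. *)
Definition nonmeager (V : topologicalType) :=
  forall A : nat -> set V, (forall n, closed (A n)) ->
    (forall x, exists n, A n x) -> exists n (x : V), nbhs x (A n).

Lemma nonmeager_count (V : topologicalType) (I : countType) (A : I -> set V) :
  nonmeager V -> (forall i, closed (A i)) -> (forall x, exists i, A i x) ->
  exists i (x : V), nbhs x (A i).
Proof.
move=> nmV clA covA.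
pose B k := if @unpickle I k is Some i then A i else set0.
have [k|x|k [x]] := nmV B.
- by rewrite /B; case: unpickle => [i|]; [exact: clA|exact: closed0].
- by have [i Aix] := covA x; exists (pickle i); rewrite /B pickleK.
rewrite /B; case: unpickle => [i|]; first by exists i, x.
by move=> /nbhs_singleton.
Qed.

Lemma closed_normr_le (K : numFieldType) (V : topologicalType) (f : V -> K)
  (M : K) : continuous f -> closed [set x | `|f x| <= M].
Proof.
move=> cf.
have -> : [set x | `|f x| <= M] = f @^-1` [set z | `|z| <= M] by [].
apply: preimage_closed; first by move=> x _; exact: cf.
move=> x clx /=.
have near_x e : 0 < e -> exists2 z, `|z| <= M & `|x - z| < e.
  move=> e0; have [z [/= zM xz]] := clx _ (nbhsx_ballx x e e0).
  by exists z => //; move: xz; rewrite -ball_normE.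
have [z0 z0M _] := near_x 1 ltr01.
have M0 : 0 <= M := le_trans (normr_ge0 _) z0M.
have [//|Mx] := real_leP (normr_real x) (ger0_real M0).
have [z zM] := near_x (`|x| - M) ltac:(by rewrite subr_gt0).
rewrite ltrBrDr => lt; suff : `|x| < `|x| by rewrite ltxx.
apply: le_lt_trans lt; rewrite -[X in `|X|](subrK z).
by rewrite (le_trans (ler_normD _ _))// lerD2l.
Qed.

Section UniformBoundedness.
Context (K : numFieldType) (V : tvsType K).
Hypothesis nmV : nonmeager V.


(** Unlike the usual statement, the bounds w j are functions of n: this is uniform
boundedness of y n relative to one of countably many possible growth rates,
which Baire selects. *)
Lemma banach_steinhaus (y : nat -> V -> K) (w : nat -> nat -> K) :
    (forall n, linear (y n : V -> K^o)) -> (forall n, continuous (y n)) ->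
    (forall x, exists j (N : nat), forall n, `|y n x| <= N%:R * w j n) ->
  exists j (N : nat), nbhs 0 [set x | forall n, `|y n x| <= N%:R * w j n].
Proof.
move=> liny cy bndy.
pose A (p : nat * nat) := [set x | forall n, `|y n x| <= p.2%:R * w p.1 n].
have clA p : closed (A p).
  rewrite (_ : A p = \bigcap_n [set x | `|y n x| <= p.2%:R * w p.1 n]).
    by apply: closed_bigI => n _; exact: closed_normr_le.
  by apply/seteqP; split=> x h; [move=> n _; exact: h|move=> n; exact: h].
have [x|[j N] [x0 Ax0]] := nonmeager_count nmV clA.
  by have [j [N h]] := bndy x; exists (j, N).
exists j, (N + N)%N; have := nbhsB (- x0) Ax0; rewrite addNr; apply: filterS.
move=> _ [x Ax <-] n /=; rewrite addrC (linear_scalarB (liny n)).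
rewrite natrD mulrDl (le_trans (ler_normB _ _))// lerD//.
exact: (nbhs_singleton Ax0).
Qed.

End UniformBoundedness.

Section FinitePartsNonmeager.
Context (K : numFieldType) (V : tvsType K).
Hypothesis nmV : nonmeager V.
Hypothesis archK : Num.archimedean_axiom K.
Context (disp : Order.disp_t) (T : orderType disp).
Context (P : set T) (G : T -> nat -> K).
Hypothesis G_gt0 : forall a n, P a -> 0 < G a n.
Hypothesis G_ratio : forall a b, P a -> P b -> (a < b)%O ->
  (fun n => G a n / G b n) @ \oo --> (0 : K).
Hypothesis G_inv : forall a, P a -> cvg ((fun n => (G a n)^-1) @ \oo).

Lemma cvg_natr_bounded (u : nat -> K) (l : K) : u @ \oo --> l ->
  exists N : nat, forall n, `|u n| <= N%:R.
Proof.
move=> ul; have /cvg_seq_bounded[M [Mreal uM]] : cvgn (u : nat -> K^o).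
  by apply/cvg_ex; exists l.
have [N MN] := archK M; exists N => n.
by apply: (uM N%:R _ n I); apply: le_lt_trans MN; exact: real_ler_norm.
Qed.

(** The sequence c is cofinal among the exponents that occur.  Each x is of order
O(G (c j)) for some j; by uniform boundedness, one j serves a whole
neighbourhood of 0, hence all x, so no exponent exceeds c j.  The coefficient
of c j is the pointwise limit of y n / G (c j), which is bounded by N on that
neighbourhood. *)
Lemma leading_coef_continuous (y : nat -> V -> K) (r : V -> T -> K)
    (c : nat -> T) :
    (forall n, linear (y n : V -> K^o)) -> (forall n, continuous (y n)) ->
    (forall x, expands P G (y ^~ x) (r x)) -> (forall j, P (c j)) ->
    (forall x a, r x a != 0 -> exists j, (a <= c j)%O) ->
  exists j, (forall x a, r x a != 0 -> (a <= c j)%O) /\ continuous (r ^~ (c j)).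
Proof.
move=> liny cy yr Pc cofc.
have lead x b : P b -> (forall a, (b < a)%O -> r x a = 0) ->
  (fun n => y n x / G b n) @ \oo --> r x b.
  by move=> Pb; exact: (expands_leading G_gt0 G_ratio G_inv Pb (yr x)).
have linr a : linear (r ^~ a : V -> K^o).
  exact: (expands_coef_linear G_gt0 G_ratio G_inv _ liny yr).
have [|j [N U0]] := @banach_steinhaus _ _ nmV y (fun j => G (c j)) liny cy.
  move=> x; have [j xj] : exists j, forall a, (c j < a)%O -> r x a = 0.
    have [[a ra]|rx0] := pselect (exists a, r x a != 0).
      have [b [rb _ bmax]] := expands_max (yr x) ra.
      have [j bj] := cofc x b rb; exists j => d jd.
      by apply: bmax; exact: le_lt_trans jd.
    exists 0%N => a _; apply/eqP; apply: contraT => ra; exfalso.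
    by apply: rx0; exists a.
  have [N yN] := cvg_natr_bounded (lead x _ (Pc j) xj).
  exists j, N => n; have := yN n.
  by rewrite normf_div (gtr0_norm (G_gt0 _ (Pc j))) ler_pdivrMr ?G_gt0.
have yU x n : (forall n, `|y n x| <= N%:R * G (c j) n) ->
    `|y n x / G (c j) n| <= N%:R.
  by move=> Ux; rewrite normf_div (gtr0_norm (G_gt0 _ (Pc j))) ler_pdivrMr ?G_gt0.
have top x a : r x a != 0 -> (a <= c j)%O.
  have [k k0 Ux] := nbhs0_absorbs x U0; move=> rxa.
  have rkxa : r (k *: x) a != 0.
    by rewrite (linear_scalarZ (linr a)) mulf_neq0// gt_eqF.
  have [b [rb ab bmax]] := expands_max (yr _) rkxa.
  (* An exponent b above c j would have the coefficient lim y n / G b, which is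
     0 because y n is of order G (c j). *)
  apply: (le_trans ab); rewrite leNgt; apply/negP => cb.
  have Pb := expandsP (yr _) rb.
  move: rb; apply/negP; rewrite negbK.
  have := lead _ b Pb bmax; set u := (fun n => _) => ub.
  suff : u @ \oo --> (0 : K).
    move=> u0; apply/eqP.
    exact: (cvg_unique (@norm_hausdorff _ _) ub u0).
  apply/cvgrPdist_lt => e e0.
  have : (fun n => N%:R * (G (c j) n / G b n)) @ \oo --> (0 : K).
    by rewrite -[X in _ --> X](mulr0 N%:R); apply: cvgMr; exact: G_ratio.
  move=> /cvgrPdist_lt/(_ e e0); apply: filterS => n.
  rewrite !sub0r !normrN => lt; apply: le_lt_trans lt.
  rewrite /u normrM [leRHS]normrM normf_div normfV normr_nat mulrA.
  rewrite (gtr0_norm (G_gt0 _ Pb)) (gtr0_norm (G_gt0 _ (Pc j))).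
  by rewrite ler_pM2r ?invr_gt0 ?G_gt0//; exact: Ux.
exists j; split=> //.
apply: (linear_scalar_continuous (linr _) U0) => x Ux.
have rj a : (c j < a)%O -> r x a = 0.
  move=> ja; apply/eqP; apply: contraT => /top.
  by rewrite leNgt ja.
have := lead x _ (Pc j) rj.
apply: (closed_cvg [set z : K | `|z| <= N%:R]); last exact: nearW (yU x ^~ Ux).
by apply: (@closed_normr_le K K idfun) => z; exact: cvg_id.
Qed.

Hypothesis cofinal_seq : forall E : set T, E !=set0 ->
  exists c : nat -> T, (forall n, E (c n)) /\
    forall a, E a -> exists n, (a <= c n)%O.

Lemma expands_erase (g : nat -> K) (r : T -> K) (s : seq T) :
    uniq s -> {in s, forall a, P a} -> expands P G g r ->
  expands P G (fun n => g n - \sum_(a <- s) G a n * r a)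
    (fun a => if a \in s then 0 else r a).
Proof.
move=> us sP gr.
have es : expands P G (fun n => \sum_(a <- s) G a n * r a)
    (fun a => if a \in s then r a else 0).
  exists s; split=> //; first by move=> a /negPf ->.
  rewrite (_ : (fun n => _) = fun=> 0); first exact: cvg_cst.
  apply/funext => n; apply/eqP; rewrite subr_eq0; apply/eqP.
  by apply: eq_big_seq => a ->.
have := expands_linear (-1) es gr; congr expands.
  by apply/funext => n; rewrite mulN1r addrC.
by apply/funext => a; case: ifP; rewrite mulN1r ?addNr// oppr0 add0r.
Qed.

(** Peeling off the leading term again and again would require knowing that this
ends.  Instead, the set C of exponents with nonzero continuous coefficient is
finite at once, and removing all of C leaves nothing, since otherwise the
largest remaining exponent would have a continuous coefficient. *)
Theorem expands_coef_continuous (y : nat -> V -> K) (r : V -> T -> K) :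
    (forall n, linear (y n : V -> K^o)) -> (forall n, continuous (y n)) ->
    (forall x, expands P G (y ^~ x) (r x)) ->
  forall a, continuous (r ^~ a).
Proof.
move=> liny cy yr.
have linr a : linear (r ^~ a : V -> K^o).
  exact: (expands_coef_linear G_gt0 G_ratio G_inv _ liny yr).
pose C := [set a | (exists x, r x a != 0) /\ continuous (r ^~ a)].
(* If C were infinite, the kernels of a sequence of coefficients in C would cover
   V, as each x has finitely many exponents; one kernel would have an interior
   point and so be all of V. *)
have finC : finite_set C.
  apply: contrapT => /infiniteP/card_leP[f0].
  pose nat_val n : set_type [set: nat] := SigSub (mem_set (I : [set: nat] n)).
  pose f n : T := val (f0 (nat_val n)).
  have fC n : C (f n) by apply: set_mem; exact: valP.
  have finj : injective f.
    by move=> m n /val_inj/(inj (f := f0)); rewrite !inE => /(_ I I) [].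
  pose A n := [set x | `|r x (f n)| <= 0].
  have [n|x|n [x Anx]] := nmV (A := A).
  - by apply: closed_normr_le; have [] := fC n.
  - have [s [_ _ r0 _]] := yr x; apply: contrapT => h.
    have fs n : f n \in s.
      apply: contraT => /r0 rn; exfalso; apply: h; exists n.
      by rewrite /A /= rn normr0.
    have /(uniq_leq_size) : uniq [seq f n | n <- iota 0 (size s).+1].
      by rewrite map_inj_uniq ?iota_uniq.
    move=> /(_ s); rewrite size_map size_iota ltnn => H.
    by have /H : {subset [seq f n | n <- iota 0 (size s).+1] <= s}
      by move=> _ /mapP[n _ ->].
  - have [[z /eqP rz] _] := fC n; apply: rz.
    have := nbhsB (- x) Anx; rewrite addNr => /(nbhs0_absorbs z)[k k0 [v Av e]].
    have ker u : A n u -> r u (f n) = 0.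
      by rewrite /A /= normr_le0 => /eqP.
    have : r (k *: z) (f n) = 0.
      rewrite -e addrC (linear_scalarB (linr _)) !ker ?subrr//.
      exact: nbhs_singleton.
    rewrite (linear_scalarZ (linr _)) => /eqP.
    by rewrite mulf_eq0 gt_eqF//= => /eqP.
have [s0 sC] := (finite_seqP C).1 finC.
pose s := undup s0.
have sE a : (a \in s) <-> C a by rewrite mem_undup sC.
have sP : {in s, forall a, P a}.
  by move=> a /sE[[x rx] _]; exact: expandsP (yr x) rx.
move=> a; apply: contrapT => ncont_a.
have [x0 ra] : exists x, r x a != 0.
  apply: contrapT => h; apply: ncont_a.
  rewrite (_ : r ^~ a = fun=> 0); first by move=> x; exact: cvg_cst.
  apply/funext => x; apply/eqP; apply: contraT => rx; exfalso; apply: h.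
  by exists x.
pose E := [set b | b \notin s /\ exists x, r x b != 0].
have Ea : E a by split; [apply/negP => /sE[]|exists x0].
have [c [Ec cofc]] := cofinal_seq (ex_intro _ a Ea).
pose y' n x := y n x - \sum_(b <- s) G b n * r x b.
pose r' x b := if b \in s then 0 else r x b.
have [n u v w| n |x|j|x b|j [_ cj]] := @leading_coef_continuous y' r' c.
- rewrite /y' liny; under eq_bigr do rewrite linr mulrDr mulrCA.
  by rewrite big_split /= -mulr_sumr opprD addrACA scalerBr.
- move=> x; apply: cvgB; first exact: cy.
  rewrite big_seq; under eq_fun do rewrite big_seq.
  apply: cvg_big => [|b /sE[_ cb]]; first exact: add_continuous.
  by apply: cvgMr; exact: cb.
- exact: expands_erase (undup_uniq _) sP (yr x).
- by have [_ [x rx]] := Ec j; exact: expandsP (yr x) rx.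
- rewrite /r'; case: ifP => [_|/negbT bs rx]; first by rewrite eqxx.
  by apply: cofc; split=> //; exists x.
have [cs ncj] := Ec j; move/negP: (cs); apply; apply/sE; split=> //.
rewrite (_ : r ^~ (c j) = r' ^~ (c j))//.
by apply/funext => x; rewrite /r' (negPf cs).
Qed.

End FinitePartsNonmeager.

(** * Real and complex scalars *)

Section Scalars.
Context (R : realType) (k : scalar_kind).
Local Notation K := (scalars R k).
Local Notation sc := (@to_scalars R k).

Lemma to_scalars0 : sc 0 = 0. Proof. by case: k => //; rewrite /= rmorph0. Qed.
Lemma to_scalars1 : sc 1 = 1. Proof. by case: k => //; rewrite /= rmorph1. Qed.
Lemma to_scalarsD x y : sc (x + y) = sc x + sc y.
Proof. by case: k => //=; rewrite rmorphD. Qed.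
Lemma to_scalarsM x y : sc (x * y) = sc x * sc y.
Proof. by case: k => //=; rewrite rmorphM. Qed.
Lemma to_scalarsV x : sc x^-1 = (sc x)^-1.
Proof. by case: k => //=; rewrite fmorphV. Qed.
Lemma to_scalars_nat n : sc n%:R = n%:R.
Proof. by case: k => //=; rewrite rmorph_nat. Qed.
Lemma to_scalarsX x n : sc (x ^+ n) = sc x ^+ n.
Proof. by case: k => //=; rewrite rmorphXn. Qed.
Lemma ler_to_scalars x y : (sc x <= sc y) = (x <= y).
Proof. by case: k => //=; exact: lecR. Qed.
Lemma ltr_to_scalars x y : (sc x < sc y) = (x < y).
Proof. by case: k => //=; exact: ltcR. Qed.
Lemma normr_to_scalars x : `|sc x| = sc `|x|.
Proof.
by case: k => //=; rewrite normc_def /= expr0n addr0 sqrtr_sqr.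
Qed.

Lemma to_scalars_ge0 (z : K) : 0 <= z -> exists x, z = sc x.
Proof.
case: k z => [|] z z0 /=; first by exists z.
by exists (complex.Re z); rewrite -[LHS]RRe_real// ger0_real.
Qed.

Lemma scalars_archimedean : Num.archimedean_axiom K.
Proof.
move=> z; have [x zx] := to_scalars_ge0 (normr_ge0 z).
exists (Num.bound x); rewrite zx -to_scalars_nat ltr_to_scalars.
by apply: archi_boundP; rewrite -ler_to_scalars to_scalars0 -zx.
Qed.

Lemma to_scalars_cvg0 (u : nat -> R) : u @ \oo --> (0 : R) ->
  (fun n => sc (u n)) @ \oo --> (0 : K).
Proof.
move=> u0; apply/cvgrPdist_lt => e e0.
have [x ex] := to_scalars_ge0 (ltW e0).
have x0 : 0 < x by rewrite -ltr_to_scalars to_scalars0 -ex.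
move/cvgrPdist_lt: u0 => /(_ x x0); apply: filterS => n.
by rewrite !sub0r !normrN normr_to_scalars ex ltr_to_scalars.
Qed.

End Scalars.

(** * Cofinality of the lexicographical order *)

(** If S has no maximum, choose for each rational q an element of S above q
whenever there is one. *)
Lemma real_cofinal_seq (R : realType) (S : set R) : S !=set0 ->
  exists c : nat -> R, (forall n, S (c n)) /\
    forall x, S x -> exists n, x <= c n.
Proof.
move=> [x0 Sx0].
have [[x [Sx xmax]]|nomax] := pselect (exists x, S x /\ forall y, S y -> y <= x).
  by exists (fun=> x); split=> // y /xmax; exists 0%N.
have above q : exists y, S y /\ ((exists y', S y' /\ ratr q < y') -> ratr q < y).
  have [[y' [Sy' qy']]|h] := pselect (exists y', S y' /\ ratr q < y').
    by exists y'.
  by exists x0; split=> // /h.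
have [f hf] := choice above.
exists (fun n => if @unpickle rat n is Some q then f q else x0); split.
  by move=> n; case: unpickle => // q; have [] := hf q.
move=> x Sx.
have [y [Sy xy]] : exists y, S y /\ x < y.
  apply: contrapT => h; apply: nomax; exists x; split=> // y Sy.
  by rewrite leNgt; apply/negP => xy; apply: h; exists y.
have [q] := rat_in_itvoo xy; rewrite in_itv /= => /andP[xq qy].
exists (pickle q); rewrite pickleK ltW// (lt_trans xq)//.
by have [_] := hf q; apply; exists y.
Qed.

(** Induction on the number j of coordinates, counted from the end, in which the
elements of E may differ.  Choose a cofinal sequence s for the values of the
first free coordinate; above each s n take a cofinal sequence of the slice of E
where this coordinate equals s n.  An element whose coordinate is smaller than
s n lies below the whole slice. *)
Lemma lexi_cofinal_seq (R : realType) (m : nat) (E : set (m.-tuplelexi R)) :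
  E !=set0 -> exists c : nat -> m.-tuplelexi R, (forall n, E (c n)) /\
    forall a, E a -> exists n, (a <= c n)%O.
Proof.
suff H j : (j <= m)%N -> forall E : set (m.-tuplelexi R), E !=set0 ->
    (forall a b, E a -> E b -> forall i : 'I_m, (i < m - j)%N ->
      tnth a i = tnth b i) ->
    exists c : nat -> m.-tuplelexi R, (forall n, E (c n)) /\
      forall a, E a -> exists n, (a <= c n)%O.
  by move=> E0; apply: (H m) => // a b _ _ i; rewrite subnn.
elim: j => [_ {}E [a Ea] agree|j IH jm {}E E0 agree].
  exists (fun=> a); split=> // b Eb; exists 0%N.
  rewrite (_ : b = a)//; apply: eq_from_tnth => i.
  by apply: agree; rewrite // subn0.
have jlt : (m - j.+1 < m)%N by rewrite ltn_subrL (leq_ltn_trans _ jm).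
pose i0 := Ordinal jlt.
have [|s [Ss cofs]] := @real_cofinal_seq R [set tnth a i0 | a in E].
  by have [a Ea] := E0; exists (tnth a i0), a.
have sub n : exists d : nat -> m.-tuplelexi R,
    (forall k, E (d k) /\ tnth (d k) i0 = s n) /\
    forall a, E a -> tnth a i0 = s n -> exists k, (a <= d k)%O.
  have [|||d [Ed cofd]] := IH _ (E `&` [set a | tnth a i0 = s n]).
  - exact: ltnW.
  - by have [a Ea as_] := Ss n; exists a.
  - move=> a b [Ea /= ai] [Eb /= bi] i.
    rewrite -subSS subSn// ltnS leq_eqVlt => /predU1P[ii0|]; last exact: agree.
    by rewrite (_ : i = i0) ?ai ?bi//; exact: val_inj.
  by exists d; split=> // a Ea ai; exact: cofd.
have [d hd] := choice sub.
pose c n := if @unpickle (nat * nat)%type n is Some p then d p.1 p.2 else d 0%N 0%N.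
exists c; split.
  by move=> n; rewrite /c; case: unpickle => [p|]; [have [/(_ p.2)[]] := hd p.1|
    have [/(_ 0%N)[]] := hd 0%N].
move=> a Ea; have [|n an] := cofs (tnth a i0); first by exists a.
move: an; rewrite le_eqVlt => /predU1P[an|an].
  have [_ /(_ a Ea an)[p ap]] := hd n.
  by exists (pickle (n, p)); rewrite /c pickleK.
exists (pickle (n, 0%N)); rewrite /c pickleK /=.
have [/(_ 0%N)[Ed dn] _] := hd n.
apply: ltW; apply/Order.TupleLexiOrder.ltxi_tuplePlt; exists i0.
  by move=> i ii0; apply: agree.
by rewrite dn.
Qed.

(** * Growth of the basic functions *)

Section Scale.
Context (R : realType) (m : nat) (L : set R) (F : 'I_m -> R -> R).

Lemma unbounded_domain_seq : unbounded_domain L -> exists l : nat -> R,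
  (forall n, L (l n)) /\ l @ \oo --> infty_in L.
Proof.
move=> [_ unboundedL].
have ex (n : nat) : exists x, L x /\ n%:R < x.
  apply: contrapT => h; apply: unboundedL; exists n%:R => x Lx.
  by rewrite leNgt; apply/negP => nx; apply: h; exists x.
have [l hl] := choice ex; exists l; split; first by move=> n; have [] := hl n.
move=> A [M [_ MA]]; have := nbhs_infty_gtr M; apply: filterS => n /= Mn.
by have [Ll nl] := hl n; apply: MA => //; exact: lt_trans nl.
Qed.

Hypothesis sysF : basic_system L F.
Context (l : nat -> R).
Hypothesis Ll : forall n, L (l n).
Hypothesis l_infty : l @ \oo --> infty_in L.

Let p j n := ln (F j (l n)).

Let F_gt0 j n : 0 < F j (l n). Proof. exact: bs_pos sysF _ _ _. Qed.

(** All growth comparisons are made on logarithms: F^a is the exponential of a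
linear form in the logarithms p j of the F_j, and F_(j+1) = o(F_j^e) for all
e > 0 amounts to p (j+1) = o(p j). *)
Lemma ln_basic_infty j : p j @ \oo --> +oo.
Proof.
apply/cvgryPge => A.
have /cvgryPge/(_ (expR A)) : (fun n => F j (l n)) @ \oo --> +oo.
  exact: cvg_comp l_infty (bs_infty sysF j).
by apply: filterS => n le; rewrite -[A]expRK ler_ln ?posrE ?expR_gt0.
Qed.

Lemma ln_basic_ratio_next (i j : 'I_m) : j = i.+1 :> nat ->
  (fun n => p j n / p i n) @ \oo --> (0 : R).
Proof.
move=> ij; apply/cvgr0Pnorm_le => e e0.
have /eqoP/(_ 1 ltr01) := bs_littleo sysF ij e0.
move=> /l_infty; rewrite /= => nearF.
have pi0 : \forall n \near \oo, 0 < p i n.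
  by have /cvgryPgt := ln_basic_infty i; apply.
have pj0 : \forall n \near \oo, 0 < p j n.
  by have /cvgryPgt := ln_basic_infty j; apply.
near=> n; have pin : 0 < p i n by near: n.
have pjn : 0 < p j n by near: n.
rewrite ger0_norm; last by rewrite divr_ge0 ?ltW.
rewrite ler_pdivrMr// -ln_powR ler_ln ?posrE ?powR_gt0//.
have : `|F j (l n)| <= 1 * `|F i (l n) `^ e| by near: n.
by rewrite mul1r !gtr0_norm ?powR_gt0.
Unshelve. all: by end_near. Qed.

Lemma ln_basic_ratio (i j : 'I_m) : (i < j)%N ->
  (fun n => p j n / p i n) @ \oo --> (0 : R).
Proof.
move=> /subnKC; set d := (j - i.+1)%N; clearbody d.
elim: d j => [|d IH] j; first by rewrite addn0 => ij; exact: ln_basic_ratio_next.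
move=> ij; have j'lt : (i.+1 + d < m)%N.
  by rewrite (leq_trans _ (ltn_ord j))// -ij addnS.
pose j' := Ordinal j'lt.
have r1 : (fun n => p j' n / p i n) @ \oo --> (0 : R) by exact: IH.
have r2 : (fun n => p j n / p j' n) @ \oo --> (0 : R).
  by apply: ln_basic_ratio_next; rewrite /= -ij addnS.
rewrite -[X in _ --> X](mulr0 0); apply: (cvg_trans _ (cvgM r2 r1)).
apply: near_eq_cvg.
have /cvgryPgt/(_ 0) := ln_basic_infty j'; apply: filterS => n pj' /=.
by rewrite mulrA divfK// gt_eqF.
Qed.

Lemma basic_fun_ln (a : m.-tuplelexi R) n :
  basic_fun F a (l n) = expR (\sum_(j < m) tnth a j * p j n).
Proof.
rewrite expR_sum; apply: eq_bigr => j _.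
by rewrite /powR gt_eqF.
Qed.

(** If i is the first coordinate where a and b differ, the sum divided by p i tends
to b_i - a_i > 0: the terms before i vanish and those after i are o(p i). *)
Lemma exponent_gap_infty (a b : m.-tuplelexi R) : (a < b)%O ->
  (fun n => \sum_(j < m) (tnth b j - tnth a j) * p j n) @ \oo --> +oo.
Proof.
move=> /Order.TupleLexiOrder.ltxi_tuplePlt[i agree lt_i].
pose d j := tnth b j - tnth a j.
have di : 0 < d i by rewrite subr_gt0.
have pi := ln_basic_infty i.
have quot : (fun n => \sum_(j < m) d j * (p j n / p i n)) @ \oo --> d i.
  rewrite -[X in _ --> X]mulr1.
  have -> : d i * 1 = \sum_(j < m) d j * (j == i)%:R :> R.
    rewrite (bigD1 i)//= eqxx big1 ?addr0// => j /negPf ->.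
    by rewrite mulr0.
  apply: cvg_big => [|j _]; first exact: add_continuous.
  case: (ltngtP j i) => [ji|ij|/val_inj ->].
  - rewrite /d agree// subrr !mul0r.
    rewrite (_ : (fun n => _) = fun=> 0); first exact: cvg_cst.
    by apply/funext => n; rewrite mul0r.
  - rewrite (_ : (j == i) = false); last by apply: gtn_eqF.
    by apply: cvgMr; exact: ln_basic_ratio.
  - rewrite eqxx; apply: cvgMr.
    apply: cvg_near_cst.
    have /cvgryPgt/(_ 0) := pi; apply: filterS => n pin.
    by rewrite divff// gt_eqF.
have half : \forall n \near \oo, d i / 2 < \sum_(j < m) d j * (p j n / p i n).
  by move/cvgrPdist_lt: quot => /(_ (d i / 2)); rewrite divr_gt0// => /(_ isT);
    apply: filterS => n; rewrite ltr_distlC => /andP[+ _];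
    rewrite {1}[d i]splitr addrK.
apply/cvgryPge => A; have /cvgryPgt/(_ (Num.max 0 (A / (d i / 2)))) := pi.
apply: filterS2 half => n hn; rewrite gt_max => /andP[pi0 pA].
rewrite (eq_bigr (fun j => p i n * (d j * (p j n / p i n)))); last first.
  by move=> j _; rewrite mulrCA [p i n * _]mulrC divfK// gt_eqF.
have half_gt0 : 0 < d i / 2 by rewrite divr_gt0.
rewrite -mulr_sumr -[A](divfK (lt0r_neq0 half_gt0)).
rewrite (le_trans (y := p i n * (d i / 2)))//.
  by rewrite ler_pM2r// ltW.
by rewrite ler_pM2l// ltW.
Qed.

(** The quotient is the exponential of - S with S tending to infinity, and
exp (- S) <= 1 / S. *)
Lemma basic_fun_ratio (a b : m.-tuplelexi R) : (a < b)%O ->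
  (fun n => basic_fun F a (l n) / basic_fun F b (l n)) @ \oo --> (0 : R).
Proof.
move=> /exponent_gap_infty/cvgryPgt gap; apply/cvgr0Pnorm_le => e e0.
have := gap e^-1; apply: filterS => n; set S := \sum_(j < m) _ => eS.
have S0 : 0 < S by rewrite (lt_trans _ eS)// invr_gt0.
rewrite !basic_fun_ln -expRN -expRD ger0_norm ?expR_ge0//.
rewrite (_ : _ + _ = - S); last first.
  rewrite /S -!sumrN -big_split /=; apply: eq_bigr => j _.
  by rewrite mulrBl opprB.
rewrite expRN -[leRHS]invrK lef_pV2 ?posrE ?expR_gt0 ?invr_gt0//.
by rewrite (le_trans (ltW eS))// (le_trans _ (expR_ge1Dx S))// lerDr.
Qed.

End Scale.

(** * Expansions with finite parts *)

Section FinitePartExpansions.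
Context (R : realType) (m : nat) (k : scalar_kind).
Local Notation K := (scalars R k).
Local Notation exps := (m.-tuplelexi R).

Definition zero_exponent : exps := [tuple 0 | i < m].

Definition nonneg_exponents : set exps := [set a | forall j, 0 <= tnth a j].

Lemma exponent_nonneg a : exponent a -> nonneg_exponents a.
Proof. by case. Qed.

Lemma exponent_neq0 a : exponent a -> a != zero_exponent.
Proof.
move=> [_ [j aj]]; apply: contra aj => /eqP ->.
by rewrite tnth_mktuple.
Qed.

Lemma zero_exponent_lt a : nonneg_exponents a -> a != zero_exponent ->
  (zero_exponent < a)%O.
Proof.
move=> a0 az; rewrite ltNge le_eqVlt negb_or az /=.
apply/negP => /Order.TupleLexiOrder.ltxi_tuplePlt[j _].
by rewrite tnth_mktuple ltNge a0.
Qed.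

Context (L : set R) (F : 'I_m -> R -> R).
Hypothesis sysF : basic_system L F.
Context (l : nat -> R).
Hypothesis Ll : forall n, L (l n).
Hypothesis l_infty : l @ \oo --> infty_in L.

Definition scale (a : exps) (n : nat) : K := to_scalars k (basic_fun F a (l n)).

Lemma scale_zero n : scale zero_exponent n = 1.
Proof.
rewrite /scale /basic_fun big1 ?to_scalars1// => j _.
by rewrite tnth_mktuple powRr0.
Qed.

Lemma scale_gt0 a n : nonneg_exponents a -> 0 < scale a n.
Proof.
move=> _; rewrite /scale -to_scalars0 ltr_to_scalars prodr_gt0// => j _.
by rewrite powR_gt0//; exact: bs_pos sysF _ _ _.
Qed.

Lemma scale_ratio a b : nonneg_exponents a -> nonneg_exponents b ->
  (a < b)%O -> (fun n => scale a n / scale b n) @ \oo --> (0 : K).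
Proof.
move=> _ _ ab; rewrite /scale.
under eq_fun do rewrite -to_scalarsV -to_scalarsM.
apply: to_scalars_cvg0; exact: (basic_fun_ratio sysF Ll l_infty ab).
Qed.

Lemma scale_inv_cvg a : nonneg_exponents a ->
  cvg ((fun n => (scale a n)^-1) @ \oo).
Proof.
move=> a0; have [->|az] := eqVneq a zero_exponent.
  under eq_fun do rewrite scale_zero invr1.
  exact: is_cvg_cst.
apply/cvg_ex; exists 0.
rewrite (_ : (fun n => _) = (fun n => scale zero_exponent n / scale a n)).
  apply: scale_ratio => //; last exact: zero_exponent_lt.
  by move=> j; rewrite tnth_mktuple.
by apply/funext => n; rewrite scale_zero mul1r.
Qed.

(** The coefficient family r vanishes at the zero exponent, which is not in
[exponent]; the finite part Y is put there. *)
Definition with_constant (Y : K) (r : exps -> K) (a : exps) : K :=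
  if a == zero_exponent then Y else r a.

Lemma fp_expansion_expands g Y r : fp_expansion L F g Y r ->
  expands nonneg_exponents scale (g \o l) (with_constant Y r).
Proof.
move=> [s [z [s_exp s_sorted rs gE zY]]].
have z_notin : zero_exponent \notin s.
  by apply/negP => /s_exp/exponent_neq0; rewrite eqxx.
exists (zero_exponent :: s); split.
- rewrite /= z_notin; apply: (sorted_uniq _ _ s_sorted).
    by move=> b a c /= ab bc; exact: lt_trans bc ab.
  by move=> a /=; rewrite ltxx.
- move=> a; rewrite in_cons => /predU1P[->|/s_exp/exponent_nonneg//].
  by move=> j; rewrite tnth_mktuple.
- move=> a; rewrite in_cons negb_or => /andP[/negPf az].
  by rewrite /with_constant az -rs negbK => /eqP.
rewrite (_ : (fun n => _) = (fun n => z (l n) - Y)).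
  by apply/subr_cvg0; exact: cvg_comp l_infty zY.
apply/funext => n; rewrite /= gE// big_cons /with_constant eqxx scale_zero mul1r.
rewrite [X in _ - (_ + X)](_ : _ = \sum_(a <- s) scale a n * r a).
  by rewrite [Y + _]addrC opprD addrACA subrr add0r.
apply: eq_big_seq => a sa; case: eqP => // az.
by rewrite -az sa in z_notin.
Qed.

Lemma fp_expansion_unique (g : R -> K) Y Y' r r' :
  fp_expansion L F g Y r -> fp_expansion L F g Y' r' -> Y = Y' /\ r = r'.
Proof.
move=> gr gr'.
have e := expands_unique scale_gt0 scale_ratio scale_inv_cvg
  (fp_expansion_expands gr) (fp_expansion_expands gr').
have r_zero Z q : fp_expansion L F g Z q -> q zero_exponent = 0.
  move=> [s [_ [s_exp _ qs _ _]]]; apply/eqP; rewrite -[_ == 0]negbK qs.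
  by apply/negP => /s_exp/exponent_neq0; rewrite eqxx.
split; first by have := e zero_exponent; rewrite /with_constant eqxx.
apply/funext => a; have [->|/negPf az] := eqVneq a zero_exponent.
  by rewrite (r_zero _ _ gr) (r_zero _ _ gr').
by have := e a; rewrite /with_constant az.
Qed.

End FinitePartExpansions.

Section FinitePartLimits.
Context (R : realType) (m : nat) (k : scalar_kind).
Local Notation K := (scalars R k).
Context (L : set R) (F : 'I_m -> R -> R).
Hypothesis unboundedL : unbounded_domain L.
Hypothesis sysF : basic_system L F.

Lemma fp_limE (g : R -> K) Y r : fp_expansion L F g Y r ->
  fp_lim L F g = Y /\ fp_coef L F g = r.
Proof.
move=> gr; have [l [Ll lL]] := unbounded_domain_seq unboundedL.
have uniq := fp_expansion_unique sysF Ll lL gr.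
split; apply: xget_subset1.
- by exists r.
- by move=> Z Z' [q /uniq[<- _]] [q' /uniq[<- _]].
- by exists Y.
- by move=> q q' [Z /uniq[_ <-]] [Z' /uniq[_ <-]].
Qed.

Lemma fp_lim_expansion (g : R -> K) : fp_exists L F g ->
  fp_expansion L F g (fp_lim L F g) (fp_coef L F g).
Proof. by move=> [Y [r gr]]; have [-> ->] := fp_limE gr. Qed.

End FinitePartLimits.

(** * Functionals on inductive limits *)

Section GraphTopology.
Context (K : numFieldType) (X : tvsType K) (f : X -> K^o).
Hypothesis linf : linear f.

Definition graph_map (x : X) : X * K^o := (x, f x).

(** The topology of this space is generated by the one of X and by f. *)
Definition graph_space := initial_topology graph_map.

HB.instance Definition _ := Uniform.on graph_space.
HB.instance Definition _ := GRing.Lmodule.on graph_space.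

Let gmap (x : graph_space) : X * K^o := graph_map x.

Let gmap_continuous : continuous gmap.
Proof. exact: initial_continuous. Qed.

Let gmapD x y : gmap (x + y) = gmap x + gmap y.
Proof. by rewrite /gmap /graph_map linear_scalarD. Qed.

Let gmapZ (a : K) x : gmap (a *: x) = a *: gmap x.
Proof. by rewrite /gmap /graph_map linear_scalarZ. Qed.

Lemma graph_add_continuous :
  continuous (fun x : graph_space * graph_space => x.1 + x.2).
Proof.
apply: continuous_comp_initial => -[x y]; rewrite /continuous_at.
rewrite (_ : _ \o _ = fun z => gmap z.1 + gmap z.2); last first.
  by apply/funext => z; rewrite /= -gmapD.
apply: continuous2_cvg; first exact: (@add_continuous (X * K^o)%type (_, _)).
  apply: (@cvg_comp _ _ _ fst gmap _ (nbhs x)); first exact: cvg_fst.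
  exact: gmap_continuous.
apply: (@cvg_comp _ _ _ snd gmap _ (nbhs y)); first exact: cvg_snd.
exact: gmap_continuous.
Qed.

Lemma graph_scale_continuous :
  continuous (fun z : K^o * graph_space => z.1 *: z.2).
Proof.
apply: continuous_comp_initial => -[a x]; rewrite /continuous_at.
rewrite (_ : _ \o _ = fun z => z.1 *: gmap z.2); last first.
  by apply/funext => z; rewrite /= -gmapZ.
apply: continuous2_cvg.
- exact: (@scale_continuous K (X * K^o)%type (_, _)).
- exact: cvg_fst.
- apply: (@cvg_comp _ _ _ snd gmap _ (nbhs x)); first exact: cvg_snd.
  exact: gmap_continuous.
Qed.

Lemma graph_locally_convex : exists2 B : set_system graph_space,
  (forall b, b \in B -> convex_set b) & basis B.
Proof.
have [B Bconvex [Bopen Bbasis]] := @locally_convex K (X * K^o)%type.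
exists [set gmap @^-1` b | b in B].
  move=> _ /[!inE] -[b Bb <-] x y t.
  rewrite !inE /= => bx bY.
  have := Bconvex b (mem_set Bb) (gmap x) (gmap y) t (mem_set bx) (mem_set bY).
  rewrite inE; congr b.
  by rewrite /conv /= gmapD !gmapZ.
split=> [_ [b Bb <-]|x U Ux].
  by apply: open_comp (Bopen _ Bb) => y _; exact: gmap_continuous.
rewrite nbhsE in Ux; case: Ux => _ [[W oW <-] Wx] WU.
have [b [Bb bx] bW] := Bbasis (gmap x) W (open_nbhs_nbhs (conj oW Wx)).
exists (gmap @^-1` b); first by split; [exists b|].
by move=> z bz; apply: WU; exact: bW.
Qed.

HB.instance Definition _ :=
  PreTopologicalNmodule_isTopologicalNmodule.Build graph_space
    graph_add_continuous.
HB.instance Definition _ :=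
  TopologicalNmodule_isTopologicalLmodule.Build K graph_space
    graph_scale_continuous.
HB.instance Definition _ :=
  Uniform_isTvs.Build K graph_space graph_locally_convex.

Definition graph_tvs : tvsType K := graph_space.

Lemma graph_tvs_continuous : continuous (f : graph_tvs -> K).
Proof.
move=> x; apply: (@cvg_comp _ _ _ gmap snd _ (nbhs (gmap x))).
  exact: gmap_continuous.
exact: cvg_snd.
Qed.

Lemma continuous_into_graph (V : topologicalType) (u : V -> X) :
  continuous u -> continuous (f \o u) -> continuous (u : V -> graph_tvs).
Proof.
move=> cu cfu; apply: continuous_comp_initial => v.
exact: (cvg_pair (cu v) (cfu v)).
Qed.

End GraphTopology.

(** The identity from X to X with the topology generated by f is continuous on
each X_i, hence continuous. *)
Lemma inductive_limit_continuous (R : realType) (k : scalar_kind)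
    (I : Type) (le : I -> I -> Prop) (X_ : I -> tvsType (scalars R k))
    (v : forall i j, X_ i -> X_ j) (X : tvsType (scalars R k))
    (u : forall i, X_ i -> X) (f : X -> scalars R k) :
  inductive_limit le v u -> linear (f : X -> (scalars R k)^o) ->
  (forall i, continuous (f \o u i)) -> continuous f.
Proof.
move=> limX linf cfu.
have cid : continuous (idfun : X -> graph_tvs linf).
  have bij : bijective (idfun : X -> graph_tvs linf) by exists idfun.
  apply: (il_finest limX (E := graph_tvs linf) (f := idfun)) => // i.
  by apply: continuous_into_graph; [exact: il_continuous limX i|exact: cfu].
move=> x; apply: (@cvg_comp _ _ _ (idfun : X -> graph_tvs linf) f
  _ (@nbhs _ (graph_tvs linf) x)).
  exact: cid.
exact: graph_tvs_continuous.
Qed.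

(** * Continuity of the finite part *)

Lemma frechet_nonmeager (R : realType) (k : scalar_kind)
  (V : tvsType (scalars R k)) : frechet V -> nonmeager V.
Proof.
move=> [d [[d0 dC dT] _ nbhsE complete_d]] A clA covA.
have [n [x [e e0 ballA]]] :=
  baire_complete_metric 0 d0 dC dT nbhsE complete_d clA covA.
by exists n, x; rewrite nbhsE; exists e.
Qed.

Section FinitePartDual.
Context (R : realType) (k : scalar_kind) (m : nat).
Local Notation K := (scalars R k).
Context (L : set R) (F : 'I_m -> R -> R) (X : tvsType K) (y : R -> X -> K).
Hypothesis unboundedL : unbounded_domain L.
Hypothesis sysF : basic_system L F.
Hypothesis limX : frechet_inductive_limit X.
Hypothesis y_dual : forall l, L l -> dual X (y l).
Hypothesis y_fp : forall x, fp_exists L F (y ^~ x).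

(** All the functionals are coefficients of one expansion, the finite part being
that of the zero exponent. *)
Theorem finite_part_dual :
  dual X (fun x => fp_lim L F (y ^~ x)) /\
  forall a, exponent a -> dual X (fun x => fp_coef L F (y ^~ x) a).
Proof.
have [l [Ll lL]] := unbounded_domain_seq unboundedL.
pose r x := with_constant (fp_lim L F (y ^~ x)) (fp_coef L F (y ^~ x)).
have yr x : expands (@nonneg_exponents R m) (scale k F l)
    (fun n => y (l n) x) (r x).
  exact: (fp_expansion_expands Ll lL (fp_lim_expansion unboundedL sysF (y_fp x))).
have G_gt0 := scale_gt0 k sysF Ll.
have G_ratio := scale_ratio (k := k) sysF Ll lL.
have G_inv := scale_inv_cvg (k := k) sysF Ll lL.
have dual_r a : dual X (r ^~ a).
  have lin_r : linear (r ^~ a : X -> K^o).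
    apply: (expands_coef_linear G_gt0 G_ratio G_inv _ _ yr) => n.
    by have [] := y_dual (Ll n).
  split=> //.
  have [I [le [X_ [v [u [frechetX _ limu]]]]]] := limX.
  apply: (inductive_limit_continuous limu lin_r) => i.
  apply: (expands_coef_continuous (frechet_nonmeager (frechetX i))
    (@scalars_archimedean R k) G_gt0 G_ratio G_inv _ (y := fun n => y (l n) \o u i)
    (r := r \o u i)).
  - by move=> E; exact: lexi_cofinal_seq.
  - move=> n c x x' /=; rewrite (il_linear limu).
    by have [-> _] := y_dual (Ll n).
  - move=> n x; apply: continuous_comp; first exact: il_continuous limu i x.
    by have [_] := y_dual (Ll n); apply.
  - by move=> x; exact: yr.
split=> [|a a_exp].
  have := dual_r (zero_exponent R m); congr (dual X _).
  by apply/funext => x; rewrite /r /with_constant eqxx.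
have := dual_r a; congr (dual X _).
by apply/funext => x; rewrite /r /with_constant (negPf (exponent_neq0 a_exp)).
Qed.

Lemma fp_coef_finite x :
  finite_set [set a | exponent a /\ fp_coef L F (y ^~ x) a != 0].
Proof.
have [s [_ [_ _ rs _ _]]] := fp_lim_expansion unboundedL sysF (y_fp x).
by apply: sub_finite_set (finite_seq s) => a [_] /=; rewrite rs.
Qed.

End FinitePartDual.

(** * The finest locally convex topology on polynomials *)

Section ConvexCombinations.
Context (K : numFieldType) (E : lmodType K) (C : set E).
Hypothesis convC : convex_set (C : set (convex_lmodType E)).

Lemma convex_setP (t : K) x y : 0 <= t -> t <= 1 -> C x -> C y ->
  C (t *: x + (1 - t) *: y).
Proof.
move=> t0 t1 Cx Cy; have := convC (Itv01 t0 t1) (mem_set Cx) (mem_set Cy).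
by rewrite inE.
Qed.

(** Weights of total at most 1 suffice because C contains 0. *)
Lemma convex_set_sum (n : nat) (t : nat -> K) (e : nat -> E) : C 0 ->
  (forall i, 0 <= t i) -> (forall i, C (e i)) -> \sum_(i < n) t i <= 1 ->
  C (\sum_(i < n) t i *: e i).
Proof.
move=> C0 t0 Ce t1.
have [c [Cc ->]] : exists c, C c /\
    \sum_(i < n) t i *: e i = (\sum_(i < n) t i) *: c.
  elim: n {t1} => [|n [c [Cc IH]]].
    by exists 0; rewrite !big_ord0 scaler0.
  rewrite !big_ord_recr /= IH; set s := \sum_(i < n) t i.
  have s0 : 0 <= s by apply: sumr_ge0.
  have st0 : 0 <= s + t n by rewrite addr_ge0.
  have [st|st] := eqVneq (s + t n) 0.
    move/eqP: (st); rewrite paddr_eq0// => /andP[/eqP -> /eqP ->].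
    by exists 0; rewrite addr0 !scale0r addr0.
  exists ((s / (s + t n)) *: c + (1 - s / (s + t n)) *: e n); split.
    apply: convex_setP => //; first by rewrite divr_ge0.
    by rewrite ler_pdivrMr ?mul1r ?lerDl// lt_def st.
  have tE : (s + t n) * (1 - s / (s + t n)) = t n.
    by rewrite mulrBr mulr1 mulrCA divff// mulr1 addrC addKr.
  by rewrite scalerDr !scalerA tE mulrCA divff// mulr1.
have s0 : 0 <= \sum_(i < n) t i by exact: sumr_ge0.
by have := convex_setP s0 t1 Cc C0; rewrite scaler0 addr0.
Qed.

End ConvexCombinations.

Section WeightedNorm.
Context (K : numFieldType).
Implicit Types (w : nat -> K) (p q : {poly K}).

(** With arbitrary positive weights these norms define the finest locally convex
topology on polynomials. *)
Definition weighted_norm w p : K := \sum_(i < size p) w i * `|p`_i|.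

Lemma weighted_norm_wide w p n : (size p <= n)%N ->
  weighted_norm w p = \sum_(i < n) w i * `|p`_i|.
Proof.
move=> pn; rewrite /weighted_norm.
rewrite (big_ord_widen_cond n xpredT (fun i => w i * `|p`_i|))//= big_mkcond.
apply: eq_bigr => i _; case: ltnP => // /leq_sizeP/(_ i (leqnn _)) ->.
by rewrite normr0 mulr0.
Qed.

Lemma weighted_norm0 w : weighted_norm w 0 = 0.
Proof. by rewrite /weighted_norm size_poly0 big_ord0. Qed.

Lemma weighted_normZ w (c : K) p :
  weighted_norm w (c *: p) = `|c| * weighted_norm w p.
Proof.
rewrite (weighted_norm_wide w (size_scale_leq c p)) /weighted_norm mulr_sumr.
by apply: eq_bigr => i _; rewrite coefZ normrM mulrCA.
Qed.

Lemma weighted_normN w p : weighted_norm w (- p) = weighted_norm w p.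
Proof. by rewrite -scaleN1r weighted_normZ normrN1 mul1r. Qed.

Lemma weighted_norm_scale (c : K) w p :
  weighted_norm (fun i => c * w i) p = c * weighted_norm w p.
Proof. by rewrite mulr_sumr; apply: eq_bigr => i _; rewrite mulrA. Qed.

Lemma weighted_norm_add w w' p : weighted_norm (fun i => w i + w' i) p =
  weighted_norm w p + weighted_norm w' p.
Proof. by rewrite -big_split; apply: eq_bigr => i _; rewrite mulrDl. Qed.

Definition positive_weight w := forall i, 0 < w i.

Lemma weighted_norm_ge0 w p : positive_weight w -> 0 <= weighted_norm w p.
Proof. by move=> w0; apply: sumr_ge0 => i _; rewrite mulr_ge0// ltW. Qed.

Lemma weighted_normD w p q : positive_weight w ->
  weighted_norm w (p + q) <= weighted_norm w p + weighted_norm w q.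
Proof.
move=> w0; pose n := maxn (size p) (size q).
rewrite (weighted_norm_wide w (size_polyD p q)) -/n.
rewrite (weighted_norm_wide w (leq_maxl _ _ : (size p <= n)%N)).
rewrite (weighted_norm_wide w (leq_maxr _ _ : (size q <= n)%N)).
rewrite -big_split; apply: ler_sum => i _ /=.
by rewrite coefD -mulrDr ler_pM2l ?ler_normD.
Qed.

End WeightedNorm.

(** A copy of the type of polynomials, to carry the topology given by all the
weighted norms. *)
Definition finest_poly (K : numFieldType) := {poly K}.

Section FinestPoly.
Context (K : numFieldType).
Local Notation V := (finest_poly K).
Local Notation wn := (@weighted_norm K).

HB.instance Definition _ := GRing.Lmodule.on V.

Definition poly_entourage : set_system (V * V) :=
  filter_from (@positive_weight K) (fun w => [set pq | wn w (pq.1 - pq.2) < 1]).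

Lemma poly_entourage_filter : Filter poly_entourage.
Proof.
apply: filter_from_filter; first by exists (fun=> 1) => i; exact: ltr01.
move=> w w' w0 w'0; exists (fun i => w i + w' i).
  by move=> i; rewrite addr_gt0.
move=> [p q] /=; rewrite weighted_norm_add => lt; split; apply: le_lt_trans lt.
  by rewrite lerDl weighted_norm_ge0.
by rewrite lerDr weighted_norm_ge0.
Qed.

Lemma poly_entourage_refl A : poly_entourage A -> diagonal `<=` A.
Proof.
move=> [w w0 wA] [p q] /diagonalP ->; apply: wA.
by rewrite /= subrr weighted_norm0.
Qed.

Lemma poly_entourage_inv A : poly_entourage A -> poly_entourage A^-1%relation.
Proof.
move=> [w w0 wA]; exists w => // -[p q] /= lt; apply: wA => /=.
by rewrite -weighted_normN opprB.
Qed.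

Lemma half_weight w p q : positive_weight w -> wn (fun i => 2 * w i) p < 1 ->
  wn (fun i => 2 * w i) q < 1 -> wn w (p + q) < 1.
Proof.
move=> w0; rewrite !weighted_norm_scale => hp hq.
apply: (le_lt_trans (weighted_normD _ _ w0)).
rewrite -(@ltr_pM2l _ 2)// mulrDr mulr1.
exact: ltrD.
Qed.

Lemma poly_entourage_split A : poly_entourage A ->
  exists2 B, poly_entourage B & (B \; B)%relation `<=` A.
Proof.
move=> [w w0 wA]; exists [set pq | wn (fun i => 2 * w i) (pq.1 - pq.2) < 1].
  by exists (fun i => 2 * w i) => // i; rewrite mulr_gt0.
move=> [p q] [z /= pz zq]; apply: wA => /=.
by rewrite -[p](subrK z) -addrA; exact: half_weight.
Qed.

HB.instance Definition _ := isUniform.Build V poly_entourage_filter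
  poly_entourage_refl poly_entourage_inv poly_entourage_split.

Lemma finest_poly_nbhs (p : V) (U : set V) : nbhs p U <->
  exists2 w, positive_weight w & forall q, wn w (p - q) < 1 -> U q.
Proof.
rewrite -nbhs_entourageE; split.
  move=> [A [w w0 wA] AU]; exists w => // q lt; apply: AU.
  by apply/xsectionP; exact: wA.
move=> [w w0 wU]; exists [set pq | wn w (pq.1 - pq.2) < 1].
  by exists w.
by move=> q /xsectionP; exact: wU.
Qed.

Lemma finest_poly_add_continuous : continuous (fun x : V * V => x.1 + x.2).
Proof.
move=> [p q] U /finest_poly_nbhs[w w0 wU].
exists ([set x | wn (fun i => 2 * w i) (p - x) < 1],
  [set x | wn (fun i => 2 * w i) (q - x) < 1]) => /=.
  by split; apply/finest_poly_nbhs; exists (fun i => 2 * w i) => // i;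
    rewrite mulr_gt0.
move=> [x y] /= [px qy]; apply: wU.
by rewrite opprD addrACA; exact: half_weight.
Qed.

Lemma finest_poly_scale_continuous :
  continuous (fun z : K^o * V => z.1 *: z.2).
Proof.
move=> [a p] U /finest_poly_nbhs[w w0 wU].
pose M := wn w p + 1; have M0 : 0 < M by rewrite ltr_wpDl// weighted_norm_ge0.
pose w' i := (2 * (`|a| + 1)) * w i.
have a1 : 0 < `|a| + 1 by rewrite ltr_wpDl.
have w'0 : positive_weight w' by move=> i; rewrite !mulr_gt0.
have d0 : 0 < (2 * M)^-1 by rewrite invr_gt0 mulr_gt0.
(* As M >= 1, the radius 1 / (2 M) is also at most 1. *)
have d1 : (2 * M)^-1 <= 1.
  rewrite invf_le1 ?mulr_gt0// (le_trans (ler1n K 2))// ler_peMr//.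
  by rewrite lerDr weighted_norm_ge0.
exists (ball a (2 * M)^-1, [set x | wn w' (p - x) < 1]) => /=.
  split; first exact: (@nbhsx_ballx _ K^o).
  by apply/finest_poly_nbhs; exists w'.
move=> [b x] /= [ab px]; apply: wU.
rewrite -(subrK (b *: p) (a *: p)) -addrA -scalerBl -scalerBr.
move: ab; rewrite -ball_normE /= => abM; have ab1 := lt_le_trans abM d1.
have b1 : `|b| <= `|a| + 1.
  rewrite -[b](subrK a) addrC (le_trans (ler_normD _ _))// lerD2l.
  by rewrite distrC ltW.
apply: half_weight => //; rewrite weighted_norm_scale weighted_normZ mulrCA.
  apply: (@le_lt_trans _ _ (`|a - b| * (2 * M))).
    by rewrite ler_wpM2l// ler_wpM2l// lerDl.
  by rewrite -ltr_pdivlMr ?mulr_gt0// mul1r.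
move: px; rewrite /w' weighted_norm_scale; apply: le_lt_trans.
by rewrite mulrCA -mulrA ler_wpM2l// ler_wpM2r// weighted_norm_ge0.
Qed.

Lemma finest_poly_locally_convex : exists2 B : set_system V,
  (forall b, b \in B -> convex_set b) & basis B.
Proof.
exists [set b | exists w p, positive_weight w /\ b = [set q | wn w (p - q) < 1]].
  move=> b /[!inE] -[w [p [w0 ->]]].
  apply/convex_setW => x y; rewrite !inE /= => px py t t0 t1; rewrite inE /=.
  set tt := t%:num in t0 t1.
  change (wn w (p - (tt *: x + (1 - tt) *: y)) < 1).
  have -> : p - (tt *: x + (1 - tt) *: y) =
      tt *: (p - x) + (1 - tt) *: (p - y).
    by rewrite !scalerBr addrACA -opprD -scalerDl subrKC scale1r.
  rewrite (le_lt_trans (weighted_normD _ _ w0))// !weighted_normZ.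
  rewrite !gtr0_norm ?subr_gt0// -[ltRHS](subrKC tt 1).
  by rewrite ltrD// gtr_pMr// subr_gt0.
split=> [_ [w [p [w0 ->]]]|p U /finest_poly_nbhs[w w0 wU]].
  rewrite openE => q /= pq; apply/finest_poly_nbhs.
  pose c := 1 - wn w (p - q); have c0 : 0 < c by rewrite subr_gt0.
  exists (fun i => c^-1 * w i) => [i|x]; first by rewrite mulr_gt0 ?invr_gt0.
  rewrite weighted_norm_scale mulrC ltr_pdivrMr// mul1r ltrBrDl => lt.
  apply: le_lt_trans lt; have -> : p - x = (p - q) + (q - x).
    by rewrite addrA subrK.
  exact: weighted_normD.
exists [set q | wn w (p - q) < 1]; last by move=> q; exact: wU.
by split; [exists w, p|rewrite /= subrr weighted_norm0].
Qed.

HB.instance Definition _ :=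
  PreTopologicalNmodule_isTopologicalNmodule.Build V finest_poly_add_continuous.
HB.instance Definition _ :=
  TopologicalNmodule_isTopologicalLmodule.Build K V finest_poly_scale_continuous.
HB.instance Definition _ :=
  Uniform_isTvs.Build K V finest_poly_locally_convex.

(** Let C be a convex neighbourhood of 0 in E.  Choose w i so large that
c f(X^i) is in C for |c| <= 1 / w i.  If h has w-norm at most 1, then f h is the
combination with weights w i |h_i| of the points (h_i / (w i |h_i|)) f(X^i) of
C.  Continuity of all linear maps is the property required of the inductive
limit topology. *)
Lemma finest_poly_linear_continuous (E : tvsType K) (f : {linear V -> E}) :
  continuous f.
Proof.
move=> p U fpU; have := nbhsB (- f p) fpU; rewrite addNr => U0.
have [B Bconvex [Bopen Bbasis]] := @locally_convex K E.
have [C [BC C0] CU] := Bbasis 0 _ U0.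
have Cconvex := Bconvex C (mem_set BC).
have weight i : exists w : K, 0 < w /\
    forall c : K, `|c| * w <= 1 -> C (c *: f 'X^i).
  have nC : nbhs ((0 : K) *: f 'X^i) C.
    by rewrite scale0r; apply: open_nbhs_nbhs; split=> //; exact: Bopen.
  have [[A D] /= [A0 Dx] ADC] := @scale_continuous K E (0, f 'X^i) C nC.
  move: A0 => /nbhs_ballP[e /= e0 eA].
  exists (2 / e); rewrite divr_gt0//; split=> // c ce.
  apply: (ADC (c, f 'X^i)); split=> /=; last exact: nbhs_singleton.
  apply: eA; rewrite -ball_normE /= sub0r normrN.
  move: ce; rewrite mulrA ler_pdivrMr// mul1r -ler_pdivlMr// => ce.
  by rewrite (le_lt_trans ce)// ltr_pdivrMr// ltr_pMr// ltr1n.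
have [w hw] := choice weight.
apply/finest_poly_nbhs; exists w => [i|q pq]; first by have [] := hw i.
suff : C (f (q - p)).
  by move=> /CU[u Uu]; rewrite linearB /= addrC => /addIr <-.
set h := q - p.
have hw1 : wn w h < 1 by rewrite -weighted_normN opprB.
(* A zero coefficient gives the point 0 / 0 = 0 of C. *)
have -> : f h = \sum_(i < size h) (w i * `|h`_i|) *:
    ((h`_i / (w i * `|h`_i|)) *: f 'X^i).
  have hE : h = \sum_(i < size h) h`_i *: ('X^i : V).
    by rewrite -[LHS]coefK poly_def.
  rewrite {1}hE linear_sum; apply: eq_bigr => i _.
  rewrite scalerA mulrCA linearZ /=.
  have [->|hi] := eqVneq h`_i 0; first by rewrite mul0r.
  by rewrite divff ?mulr1// mulf_neq0 ?normr_eq0// gt_eqF//; have [] := hw i.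
apply: (convex_set_sum (t := fun i => w i * `|h`_i|)
  (e := fun i => (h`_i / (w i * `|h`_i|)) *: f 'X^i) Cconvex C0).
- by move=> i; rewrite mulr_ge0// ltW//; have [] := hw i.
- move=> i; have [wi] := hw i; apply.
  have [->|hi] := eqVneq h`_i 0; first by rewrite mul0r normr0 mul0r.
  rewrite normf_div normrM normr_id (gtr0_norm wi) mulrC mulrA.
  by rewrite divff// mulf_neq0 ?normr_eq0// gt_eqF.
- exact: ltW.
Qed.

End FinestPoly.

(** * Finite-dimensional Frechet spaces *)

Lemma rV_linear_continuous (K : numFieldType) (n : nat) (E : tvsType K)
  (f : 'rV[K]_n -> E) : linear f -> continuous f.
Proof.
move=> linf.
pose g := HB.pack_for {linear 'rV[K]_n -> E} f
  (GRing.isLinear.Build K 'rV[K]_n E *:%R f linf).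
have gE x : f x = \sum_(i < n) x 0 i *: f (delta_mx 0 i).
  rewrite -[f]/(g : _ -> _) {1}(row_sum_delta x) linear_sum.
  by apply: eq_bigr => i _; rewrite linearZ.
rewrite (funext gE); apply: continuous_big => [|i _]; first exact: add_continuous.
move=> x; pose e := f (delta_mx 0 i); have nbhs_x := nbhs_filter x.
have scale_xe := @scale_continuous K E (x 0 i, e).
have xi : (fun y : 'rV[K]_n => y 0 i) @ x --> (x 0 i : K^o).
  exact: coord_continuous.
have ee : (fun _ : 'rV[K]_n => e) @ x --> e by exact: cvg_cst.
exact: (@continuous2_cvg _ K^o E E _ nbhs_x _ _ (fun a v => a *: v) _ _
  scale_xe xi ee).
Qed.

Lemma complex_split (R : realType) (z : R[i]) (a b : R) :
  z - Complex a b = real_complex R (complex.Re z - a) +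
    Complex 0 1 * real_complex R (complex.Im z - b).
Proof.
case: z => x y; apply/eqP; rewrite eq_complex /=.
by rewrite !mul0r !mul1r ?(mulr0, addr0, subr0, oppr0, add0r) !eqxx.
Qed.

Lemma cvg_linear_combination (K : numFieldType) (s u v : nat -> K) (l c : K) :
  u @ \oo --> (0 : K) -> v @ \oo --> (0 : K) ->
  (forall n, s n - l = u n + c * v n) -> s @ \oo --> l.
Proof.
move=> u0 v0 sE; apply/subr_cvg0; rewrite (funext sE).
have : (fun n => u n + c * v n) @ \oo --> 0 + c * 0.
  by apply: cvgD => //; apply: cvgMr.
by rewrite mulr0 addr0.
Qed.

Section ScalarMetric.
Context (R : realType) (k : scalar_kind).
Local Notation K := (scalars R k).
Local Notation sc := (@to_scalars R k).

(** The norm of K takes its values in K; this recovers a real-valued metric. *)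
Definition real_part : K -> R :=
  match k return scalars R k -> R with
  | RealScalars => id
  | ComplexScalars => @complex.Re R
  end.

Lemma to_scalarsK x : real_part (sc x) = x.
Proof. by rewrite /real_part; case: k. Qed.

Lemma real_partK (z : K) : 0 <= z -> sc (real_part z) = z.
Proof. by move=> /to_scalars_ge0[x ->]; rewrite to_scalarsK. Qed.

(** The Cauchy condition is stated on sequences to match the completeness
clause of [frechet]. *)
Lemma real_cauchy_cvg (s : nat -> R) :
  (forall e, 0 < e -> exists N, forall m n, (N <= m)%N -> (N <= n)%N ->
    `|s m - s n| < e) -> exists l : R, s @ \oo --> l.
Proof.
move=> cs; exists (lim (s @ \oo)); apply/cauchy_cvgP/cauchy_exP => e e0.
have [N sN] := cs e e0; exists (s N).
by exists N => // n /= Nn; rewrite -ball_normE /=; exact: sN.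
Qed.

Lemma scalars_cauchy_cvg (s : nat -> K) :
  (forall e, 0 < e -> exists N, forall m n, (N <= m)%N -> (N <= n)%N ->
    `|s m - s n| < sc e) -> exists l : K, s @ \oo --> l.
Proof.
case: k s => [|] s cs; first exact: real_cauchy_cvg.
have [|a sa] := @real_cauchy_cvg (fun n => complex.Re (s n)).
  move=> e e0; have [N sN] := cs e e0; exists N => m n Nm Nn.
  rewrite -ltcR; apply: le_lt_trans (sN m n Nm Nn).
  rewrite -raddfB normc_def lecR -sqrtr_sqr ler_wsqrtr//.
  by rewrite lerDl sqr_ge0.
have [|b sb] := @real_cauchy_cvg (fun n => complex.Im (s n)).
  move=> e e0; have [N sN] := cs e e0; exists N => m n Nm Nn.
  rewrite -ltcR; apply: le_lt_trans (sN m n Nm Nn).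
  rewrite -raddfB normc_def lecR -sqrtr_sqr ler_wsqrtr//.
  by rewrite lerDr sqr_ge0.
pose C := scalars R ComplexScalars.
have re0 : (fun n => to_scalars ComplexScalars (complex.Re (s n) - a)) @ \oo
    --> (0 : C).
  by apply: to_scalars_cvg0; exact/subr_cvg0.
have im0 : (fun n => to_scalars ComplexScalars (complex.Im (s n) - b)) @ \oo
    --> (0 : C).
  by apply: to_scalars_cvg0; exact/subr_cvg0.
exists (Complex a b : C).
apply: (@cvg_linear_combination C s _ _ _ (Complex 0 1) re0 im0) => n.
exact: complex_split.
Qed.

Lemma rV_frechet n : frechet ('rV[K]_n : tvsType K).
Proof.
pose d (x y : 'rV[K]_n) := real_part `|x - y|.
have dE x y : sc (d x y) = `|x - y| by exact: real_partK.
have scI := can_inj to_scalarsK.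
exists d; split.
- split=> [x y|x y|x y z].
  + split=> [d0|->]; last by apply: scI; rewrite dE subrr normr0 to_scalars0.
    by apply/eqP; rewrite -subr_eq0 -normr_eq0 -dE d0 to_scalars0.
  + by apply: scI; rewrite !dE distrC.
  + by rewrite -(@ler_to_scalars R k) to_scalarsD !dE ler_distD.
- by move=> x y z; apply: scI; rewrite !dE opprD addrACA subrr addr0.
- move=> x; apply/seteqP; split=> U.
    move=> /nbhs_ballP[e /= e0 eU]; have [r er] := to_scalars_ge0 (ltW e0).
    exists r => [|y /= xy].
      by rewrite /= -(@ltr_to_scalars R k) to_scalars0 -er.
    by apply: eU; rewrite -ball_normE /= -dE er ltr_to_scalars.
  move=> [r /= r0 rU]; apply/nbhs_ballP; exists (sc r).
    by rewrite /= -(@to_scalars0 R k) ltr_to_scalars.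
  by move=> y; rewrite -ball_normE /= -dE ltr_to_scalars; exact: rU.
- move=> s cs.
  have entry i : exists l : K, (fun n => s n 0 i) @ \oo --> l.
    apply: scalars_cauchy_cvg => e e0; have [N sN] := cs e e0.
    exists N => p q Np Nq.
    have [_ /(_ 0 i)] : ball (s p) (sc e) (s q).
      by rewrite -ball_normE /= -dE ltr_to_scalars; exact: sN.
    by rewrite -ball_normE.
  have [l hl] := choice entry; exists (\row_i l i).
  apply/cvg_ballP => e e0.
  have : \forall p \near \oo, forall i, `|l i - s p 0 i| < e.
    apply: filter_forall => i.
    by move/cvgrPdist_lt: (hl i) => /(_ e e0).
  apply: filterS => p lt; split=> // i j.
  by rewrite -ball_normE /= mxE ord1.
Qed.

End ScalarMetric.

(** * Polynomials as an inductive limit *)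

Section PolynomialLimit.
Context (R : realType) (k : scalar_kind).
Local Notation K := (scalars R k).

Definition resize (i j : nat) (x : 'rV[K]_i) : 'rV[K]_j := poly_rV (rVpoly x).

Lemma resize_linear i j : linear (@resize i j).
Proof. by move=> a x y; rewrite /resize !linearP. Qed.

Lemma resizeK i j (x : 'rV[K]_i) : (i <= j)%N -> rVpoly (resize j x) = rVpoly x.
Proof. by move=> ij; rewrite poly_rV_K// (leq_trans _ ij)// size_poly. Qed.

(** K^i stands for the polynomials of size at most i, and the transition maps pad
with zeros. *)
Lemma finest_poly_limit : frechet_inductive_limit (finest_poly K : tvsType K).
Proof.
exists nat, (fun i j => (i <= j)%N), (fun i => 'rV[K]_i : tvsType K), resize,
  (fun i x => rVpoly x : finest_poly K).
have lin_u i : linear ((fun x => rVpoly x) : 'rV[K]_i -> finest_poly K).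
  by move=> a x y; rewrite linearP.
split; first by move=> i; exact: rV_frechet.
- split.
  + exact: (inhabits 0%N).
  + by [].
  + by move=> i j l; exact: leq_trans.
  + by move=> i j; exists (maxn i j); rewrite ?leq_maxl ?leq_maxr.
  + by move=> i j _; exact: resize_linear.
  + by move=> i j _; apply: rV_linear_continuous; exact: resize_linear.
  + by move=> i x; rewrite /resize rVpolyK.
  + by move=> i j l x ij jl; rewrite /resize -/(resize j x) resizeK.
- split.
  + exact: lin_u.
  + by move=> i j x ij; rewrite resizeK.
  + by move=> p; exists (size p), (poly_rV p); rewrite poly_rV_K.
  + move=> i j x y xy; exists (maxn i j); rewrite leq_maxl leq_maxr; split=> //.
    by rewrite /resize xy.
  + by move=> i; apply: rV_linear_continuous; exact: lin_u.
  + by move=> E f _ _; exact: finest_poly_linear_continuous.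
Qed.

End PolynomialLimit.

(** * Iterated logarithms *)

Section IteratedLogarithms.
Context (R : realType) (m : nat).

Definition iter_ln (j : 'I_m) (x : R) : R := iter j (@ln R) x.

(** The positivity of all the iterated logarithms is part of the domain because
the basic functions must be positive on all of it. *)
Definition iter_ln_domain : set R :=
  [set x | 1 < x /\ forall j, 0 < iter_ln j x].

Lemma ln_infty : @ln R x @[x --> +oo] --> +oo.
Proof.
apply/cvgryPge => A; apply: filterS (nbhs_pinfty_ge (num_real (expR A))) => x Ax.
by rewrite -[A]expRK ler_ln ?posrE ?expR_gt0// (lt_le_trans (expR_gt0 A)).
Qed.

Lemma iter_ln_infty j : iter_ln j x @[x --> +oo] --> +oo.
Proof.
rewrite /iter_ln; elim: (j : nat) => [|n IH]; first exact: cvg_id.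
exact: (@cvg_comp _ _ _ (iter n (@ln R)) (@ln R) _ _ _ IH ln_infty).
Qed.

(** With s = ln x this is s <= e exp (a s), which follows from
exp t >= t^2 / 2 as soon as s >= 2 / (e a^2). *)
Lemma ln_littleo_powR (a e : R) : 0 < a -> 0 < e ->
  \forall x \near +oo, `|ln x| <= e * `|x `^ a|.
Proof.
move=> a0 e0; pose s0 := 2 / (e * a ^+ 2).
have s0_gt0 : 0 < s0 by rewrite divr_gt0// mulr_gt0// exprn_gt0.
apply: filterS (nbhs_pinfty_ge (num_real (expR s0))) => x xs.
have x0 : 0 < x := lt_le_trans (expR_gt0 s0) xs.
have s0x : s0 <= ln x by rewrite -[s0]expRK ler_ln ?posrE ?expR_gt0.
have lnx : 0 < ln x := lt_le_trans s0_gt0 s0x.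
rewrite !gtr0_norm ?powR_gt0// /powR gt_eqF//.
have := expR_ge1Dxn 1 (ltW (mulr_gt0 a0 lnx)); rewrite -(ler_pM2l e0).
apply: le_trans; rewrite [X in X%:R](_ : _ = 2)//.
apply: (@le_trans _ _ (e * ((a * ln x) ^+ 2 / 2))); last first.
  by rewrite ler_pM2l// lerDr.
have -> : e * ((a * ln x) ^+ 2 / 2) = (ln x / s0) * ln x.
  by rewrite /s0 invf_div; field.
apply: ler_peMl; first exact: ltW.
by rewrite ler_pdivlMr ?mul1r.
Qed.

Lemma iter_ln_domain_unbounded : unbounded_domain iter_ln_domain.
Proof.
split; first by move=> x [].
move=> [M ubM].
have iter_pos : \forall x \near +oo, forall j, 0 < iter_ln j x.
  by apply: filter_forall => j; have /cvgryPgt := iter_ln_infty j; apply.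
have large : \forall x \near +oo, 1 < x /\ M < x.
  by apply: filter_app (nbhs_pinfty_gt (num_real M));
    apply: filterS (nbhs_pinfty_gt (num_real 1)) => x x1 Mx.
have [x [[x1 Mx] xj]] := @filter_ex _ (pinfty_nbhs R) _ _
  (@filterI _ (pinfty_nbhs R) _ _ _ large iter_pos).
by have := ubM x (conj x1 xj); rewrite leNgt Mx.
Qed.

Lemma iter_ln_basic : basic_system iter_ln_domain iter_ln.
Proof.
split.
- by move=> j x [_]; apply.
- by move=> j; apply: cvg_within_filter; exact: iter_ln_infty.
- move=> i j ij a a0; apply/eqoP => e e0.
  have : \forall x \near +oo, `|iter_ln j x| <= e * `|iter_ln i x `^ a|.
    have := iter_ln_infty i; move=> /(_ _ (ln_littleo_powR a0 e0)).
    by rewrite /iter_ln ij /=.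
  exact: filterS.
Qed.

End IteratedLogarithms.

(** * Evaluation of polynomials *)

Section PolynomialEvaluation.
Context (R : realType) (k : scalar_kind) (m : nat) (m_gt0 : (0 < m)%N).
Local Notation K := (scalars R k).
Local Notation exps := (m.-tuplelexi R).

Let i0 : 'I_m := Ordinal m_gt0.

Definition pure_exponent (n : nat) : exps :=
  [tuple if i == i0 then n%:R else 0 | i < m].

Lemma pure_exponentE n : tnth (pure_exponent n) i0 = n%:R.
Proof. by rewrite tnth_mktuple eqxx. Qed.

Lemma lt_first_coordinate (a b : exps) : tnth a i0 < tnth b i0 -> (a < b)%O.
Proof. by move=> ab; apply/Order.TupleLexiOrder.ltxi_tuplePlt; exists i0. Qed.

Lemma exponent_pure n : (0 < n)%N -> exponent (pure_exponent n).
Proof.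
move=> n0; split; last by exists i0; rewrite pure_exponentE pnatr_eq0 -lt0n.
by move=> j; rewrite tnth_mktuple; case: ifP.
Qed.

Lemma basic_fun_pure n (l : R) : 0 < l ->
  basic_fun (@iter_ln R m) (pure_exponent n) l = l ^+ n.
Proof.
move=> l0; rewrite /basic_fun (bigD1 i0)//= pure_exponentE big1 ?mulr1.
  by rewrite /iter_ln /= powR_mulrn// ltW.
by move=> j /negPf ji; rewrite tnth_mktuple ji powRr0.
Qed.

Definition eval_at (l : R) (p : finest_poly K) : K := p.[to_scalars k l].

(** The truncation recovers n from the first coordinate of (n, 0, ..., 0). *)
Definition eval_coef (p : finest_poly K) (a : exps) : K :=
  let n := Num.truncn (tnth a i0) in
  if (0 < n)%N && (a == pure_exponent n) then p`_n else 0.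

Lemma eval_coef_pure p n : (0 < n)%N -> eval_coef p (pure_exponent n) = p`_n.
Proof. by move=> n0; rewrite /eval_coef pure_exponentE natrK n0 eqxx. Qed.

(** The expansion is the polynomial itself in decreasing powers of l, with a
constant remainder, its constant term. *)
Lemma eval_fp_expansion (p : finest_poly K) :
  fp_expansion (iter_ln_domain m) (@iter_ln R m) (eval_at ^~ p) p`_0
    (eval_coef p).
Proof.
pose t := [seq n <- iota 1 (size p) | p`_n != 0].
have tP n : n \in t -> (0 < n)%N.
  by rewrite mem_filter mem_iota => /andP[_ /andP[]].
exists [seq pure_exponent n | n <- rev t], (fun=> p`_0); split.
- by move=> _ /mapP[n + ->]; rewrite mem_rev => /tP; exact: exponent_pure.
- rewrite map_rev rev_sorted sorted_map.
  apply: (@sub_sorted _ ltn) => [n n' nn'|].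
    by apply: lt_first_coordinate; rewrite !pure_exponentE ltr_nat.
  by apply: sorted_filter (iota_ltn_sorted _ _); exact: ltn_trans.
- move=> a; apply/idP/mapP => [|[n]].
    rewrite /eval_coef; set n := Num.truncn _.
    case: ifP => [/andP[n0 /eqP an] pn|]; last by rewrite eqxx.
    exists n => //; rewrite mem_rev mem_filter pn mem_iota n0 add1n ltnS.
    by apply: contraR pn; rewrite -ltnNge => /ltnW/leq_sizeP/(_ n (leqnn _)) ->.
  rewrite mem_rev => tn ->; rewrite eval_coef_pure ?tP//.
  by move: tn; rewrite mem_filter => /andP[].
- move=> l [l1 _]; have l0 : 0 < l := lt_trans ltr01 l1.
  rewrite big_map (perm_big t); last by rewrite perm_rev.
  rewrite /eval_at (@horner_coef_wide _ (size p).+1)//.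
  rewrite -(big_mkord xpredT (fun i => p`_i * to_scalars k l ^+ i)).
  rewrite big_ltn// expr0 mulr1 addrC; congr (_ + _).
  rewrite big_filter /index_iota subSS subn0 [RHS]big_mkcond.
  apply: eq_big_seq => n; rewrite mem_iota => /andP[n0 _].
  rewrite eval_coef_pure// basic_fun_pure// to_scalarsX mulrC.
  by case: eqP => //= ->; rewrite mulr0.
- have F_infty := filter_class (infty_in (iter_ln_domain m)).
  exact: (@cvg_cst K p`_0).
Qed.

Lemma eval_at_dual l : dual (finest_poly K : tvsType K) (eval_at l).
Proof.
have lin : linear (eval_at l : finest_poly K -> K^o).
  by move=> a p q; rewrite /eval_at hornerD hornerZ.
split=> //.
pose f := HB.pack_for {linear finest_poly K -> K^o} (eval_at l)
  (GRing.isLinear.Build K (finest_poly K) K^o *:%R (eval_at l) lin).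
have continuous_f := @finest_poly_linear_continuous K K^o f.
refine continuous_f.
Qed.

End PolynomialEvaluation.

(** * Finite parts of functionals *)

Lemma not_has_ubound_infinite disp (T : orderType disp) (S : set T) :
  S !=set0 -> ~ has_ubound S -> infinite_set S.
Proof.
move=> [a Sa] noub /finite_seqP[s Ss]; apply: noub.
have [|b _ bmax] := @seq_has_max _ _ s a; first by rewrite Ss in Sa.
by exists b => c; rewrite Ss => /bmax.
Qed.

Theorem theorem5p1 (R : realType) (k : scalar_kind) (m : nat) (hm : (1 <= m)%N) :
  (forall (L : set R) (F : 'I_m -> R -> R) (X : tvsType (scalars R k))
      (y : R -> X -> scalars R k),
    unbounded_domain L ->
    basic_system L F ->
    frechet_inductive_limit X ->
    (forall l, L l -> dual X (y l)) ->
    (forall x, fp_exists L F (y ^~ x)) ->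
    [/\ dual X (fun x => fp_lim L F (y ^~ x)),
        forall a, exponent a -> dual X (fun x => fp_coef L F (y ^~ x) a) &
        forall x, finite_set [set a | exponent a /\ fp_coef L F (y ^~ x) a != 0]])
  /\
  (exists (L : set R) (F : 'I_m -> R -> R) (X : tvsType (scalars R k))
      (y : R -> X -> scalars R k),
    [/\ unbounded_domain L /\ basic_system L F,
        frechet_inductive_limit X,
        forall l, L l -> dual X (y l),
        forall x, fp_exists L F (y ^~ x) &
        let S := [set a | exponent a /\ exists x, fp_coef L F (y ^~ x) a != 0] in
        infinite_set S /\ ~ has_ubound S]).
Proof.
split.
  move=> L F X y unbL sysF limX y_dual y_fp.
  have [Ydual Rdual] := finite_part_dual unbL sysF limX y_dual y_fp.
  by split=> // x; exact: fp_coef_finite.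
have unbL := @iter_ln_domain_unbounded R m.
have sysF := @iter_ln_basic R m.
exists (iter_ln_domain m), (@iter_ln R m), (finest_poly (scalars R k)),
  (@eval_at R k); split=> //.
- exact: finest_poly_limit.
- by move=> l _; exact: eval_at_dual.
- by move=> p; exists p`_0, (eval_coef hm p); exact: eval_fp_expansion.
move=> S.
have S_pure n : (0 < n)%N -> S (pure_exponent R hm n).
  move=> n0; split; first exact: exponent_pure.
  pose Xn : finest_poly (scalars R k) := 'X^n; exists Xn.
  have [_ ->] := fp_limE unbL sysF (eval_fp_expansion hm Xn).
  by rewrite eval_coef_pure// coefXn eqxx oner_eq0.
have noub : ~ has_ubound S.
  move=> [b ub_b]; pose n := (Num.truncn (tnth b (Ordinal hm))).+1.
  have := ub_b _ (S_pure n isT); rewrite leNgt lt_first_coordinate//.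
  by rewrite pure_exponentE truncnS_gt.
split=> //; apply: not_has_ubound_infinite noub.
by exists (pure_exponent R hm 1); exact: S_pure.
Qed.
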